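(* Let $(A,X)$ be a primitive axial algebra of Jordan type $\tfrac12$ over a field $\mathbb{F}$ with $\operatorname{char}\mathbb{F}\neq 2$, and let $(\cdot,\cdot)$ be its unique Frobenius form with $(x,x)=1$ for all $x\in X$. Let $a,b\in X$ and let $\langle\!\langle a,b\rangle\!\rangle$ be the subalgebra of $A$ generated by $a$ and $b$. If $(a,b)\neq\tfrac14$ or $\langle\!\langle a,b\rangle\!\rangle$ is not $3$-dimensional, then $\langle\!\langle a,b\rangle\!\rangle$ is solid.
   Context: Algebras are commutative but not necessarily associative. For an algebra $A$ over a field $\mathbb{F}$ ($\operatorname{char}\mathbb{F}\ne2$), $a\in A$ and $\lambda\in\mathbb{F}$, put $A_\lambda(a)=\{x\in A: ax=\lambda x\}$. A nonzero idempotent $a\in A$ is a $\mathcal{J}(\tfrac12)$-axis (one says: $a$ satisfies the Jordan fusion law) if $A=A_1(a)\oplus A_0(a)\oplus A_{1/2}(a)$ and $A_1(a)A_1(a)\subseteq A_1(a)$, $A_0(a)A_0(a)\subseteq A_0(a)$, $A_1(a)A_0(a)=0$, $A_1(a)A_{1/2}(a)\subseteq A_{1/2}(a)$, $A_0(a)A_{1/2}(a)\subseteq A_{1/2}(a)$, $A_{1/2}(a)A_{1/2}(a)\subseteq A_1(a)\oplus A_0(a)$. It is primitive if $A_1(a)=\mathbb{F}a$. A primitive axial algebra of Jordan type $\tfrac12$ is a pair $(A,X)$ where $X\subset A$ is a set of primitive $\mathcal{J}(\tfrac12)$-axes generating $A$ as an algebra. Frobenius form: a bilinear form on $A$ with $(x,yz)=(xy,z)$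 for all $x,y,z\in A$. It is known that there is a unique one with $(x,x)=1$ for all $x\in X$. A primitive idempotent of an algebra $B$ over a field $\mathbb{K}$ is a nonzero idempotent $c\in B$ with $\{x\in B: cx=x\}=\mathbb{K}c$. For $a,b\in X$, the subalgebra $B=\langle\!\langle a,b\rangle\!\rangle$ is solid if, for an (equivalently every) algebraic closure $\mathbb{E}$ of $\mathbb{F}$, every primitive idempotent of $B\otimes_{\mathbb{F}}\mathbb{E}$ is a $\mathcal{J}(\tfrac12)$-axis of $A\otimes_{\mathbb{F}}\mathbb{E}$. (If $a=b$, then $B=\mathbb{F}a$ and the condition holds trivially.) *)

(* Defs.v *)
From HB Require Import structures.
From mathcomp Require Import all_boot all_algebra generic_quotient.
From mathcomp Require Import boolp classical_sets.

Set Implicit Arguments.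
Unset Strict Implicit.
Unset Printing Implicit Defensive.

Import GRing.Theory.

Local Open Scope classical_set_scope.
Local Open Scope quotient_scope.
Local Open Scope ring_scope.

(* An algebra, of arbitrary dimension, is an lmodType together with a bilinear
   product [mul]; associativity and unit are not assumed. *)

Section Subspaces.
Variables (K : fieldType) (V : lmodType K).
Implicit Types S T : set V.

Definition subspace S : Prop :=
  S 0 /\ forall (k : K) (x y : V), S x -> S y -> S (k *: x + y).

Definition span S : set V := smallest subspace S.

Definition line (v : V) : set V := [set k *: v | k in [set: K]].

Definition sumset S T : set V := [set x + y | x in S & y in T].

Definition direct_sum3 (S T U : set V) : Prop :=
  forall v : V, exists! p : V * V * V,
    [/\ S p.1.1, T p.1.2, U p.2 & v = p.1.1 + p.1.2 + p.2].

Definition is_basis (n : nat) (S : set V) (v : 'I_n -> V) : Prop :=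
  (forall k : 'I_n -> K, \sum_i k i *: v i = 0 -> forall i, k i = 0) /\
  S = [set \sum_i k i *: v i | k in [set: 'I_n -> K]].

Definition has_dim (n : nat) (S : set V) : Prop :=
  exists v : 'I_n -> V, is_basis S v.

End Subspaces.

Section Algebras.
Variables (K : fieldType) (A : lmodType K) (mul : A -> A -> A).
Implicit Types S T : set A.

Definition subalgebra S : Prop :=
  subspace S /\ forall x y : A, S x -> S y -> S (mul x y).

Definition generated S : set A := smallest subalgebra S.

Definition prodset S T : set A := [set mul x y | x in S & y in T].

Definition eigenspace (k : K) (a : A) : set A := [set x | mul a x = k *: x].

Definition idempotent (a : A) : Prop := mul a a = a.

Definition jordan_axis (a : A) : Prop :=
  let A1 := eigenspace 1 a in
  let A0 := eigenspace 0 a in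
  let Ah := eigenspace 2^-1 a in
  [/\ a <> 0, idempotent a, direct_sum3 A1 A0 Ah &
      [/\ prodset A1 A1 `<=` A1, prodset A0 A0 `<=` A0 &
          prodset A1 A0 `<=` [set 0]] /\
      [/\ prodset A1 Ah `<=` Ah, prodset A0 Ah `<=` Ah &
          prodset Ah Ah `<=` sumset A1 A0]].

Definition primitive_jordan_axis (a : A) : Prop :=
  jordan_axis a /\ eigenspace 1 a = line a.

Definition primitive_axial_jordan (X : set A) : Prop :=
  commutative mul /\ X `<=` primitive_jordan_axis /\ generated X = [set: A].

(* [c] is a primitive idempotent of the subalgebra [B]; the 1-eigenspace is
   taken inside [B]. *)
Definition primitive_idempotent (B : set A) (c : A) : Prop :=
  [/\ B c, c <> 0, idempotent c & B `&` [set x | mul c x = x] = line c].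

Definition frobenius (form : A -> A -> K) : Prop :=
  forall x y z : A, form x (mul y z) = form (mul x y) z.

End Algebras.

Section BaseChange.
Variables (F E : fieldType) (iota : {rmorphism F -> E}).
Variables (A : lmodType F) (mul : {bilinear A -> A -> A}).

(* ([AE], [mulE]) with [j : x |-> x (x) 1] is the E-algebra A (x)_F E: every
   F-linear map from A to an E-module factors uniquely through j by an E-linear
   map, and the product of AE is the E-bilinear extension of that of A. *)
Definition base_change (AE : lmodType E) (mulE : {bilinear AE -> AE -> AE})
    (j : {linear A -> AE | iota \; *:%R}) : Prop :=
  (forall x y : A, mulE (j x) (j y) = j (mul x y)) /\
  forall (V : lmodType E) (f : {linear A -> V | iota \; *:%R}),
    (exists g : {linear AE -> V}, forall x, g (j x) = f x) /\
    (forall g h : {linear AE -> V},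
       (forall x, g (j x) = f x) -> (forall x, h (j x) = f x) -> g =1 h).

End BaseChange.

Section BaseChangeExists.
Variables (F E : fieldType) (iota : {rmorphism F -> E}) (A : lmodType F).

(* Formal sums of tensors, identified when no F-linear map from A to an
   E-module separates them; the quotient is a model of A (x)_F E, so that
   [base_change] is never vacuous. *)
Let ev (V : lmodType E) (f : A -> V) (s : seq (E * A)) : V :=
  \sum_(p <- s) p.1 *: f p.2.

Let teq (s t : seq (E * A)) : Prop :=
  forall (V : lmodType E) (f : {linear A -> V | iota \; *:%R}), ev f s = ev f t.

Let teqb s t := `[< teq s t >].

Fact teqb_equiv : equiv_class_of teqb.
Proof.
split=> [s|s t|s t u]; first exact/asboolP.
- by apply/asboolP/asboolP=> h V f; rewrite h.
- by move=> /asboolP h1 /asboolP h2; apply/asboolP => V f; rewrite h1 h2.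
Qed.

Canonical teqb_rel := EquivRelPack teqb_equiv.

Definition tens := {eq_quot teqb_rel}.
HB.instance Definition _ := Choice.on tens.

Let cls (s : seq (E * A)) : tens := \pi_tens s.
Let rep (x : tens) : seq (E * A) := repr x.

Let cls_eq s t : teq s t -> cls s = cls t.
Proof. by move=> h; apply/eqmodP/asboolP. Qed.

Let rep_cls s : teq (rep (cls s)) s.
Proof. by apply/asboolP; have /eqmodP := reprK (cls s). Qed.

Let cls_rep x : cls (rep x) = x.
Proof. exact: reprK. Qed.

Let sc (k : E) (s : seq (E * A)) := [seq (k * p.1, p.2) | p <- s].

Let ev_cat V f s t : @ev V f (s ++ t) = ev f s + ev f t.
Proof. by rewrite /ev big_cat. Qed.
Let ev_sc V f k s : @ev V f (sc k s) = k *: ev f s.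
Proof.
by rewrite /ev big_map scaler_sumr; apply: eq_bigr => p _; rewrite scalerA.
Qed.

Let add x y := cls (rep x ++ rep y).
Let opp x := cls (sc (-1) (rep x)).
Let zero := cls [::].
Let scal k x := cls (sc k (rep x)).

Let tP x y : teq (rep x) (rep y) -> x = y.
Proof. by move/cls_eq; rewrite !cls_rep. Qed.

Let evD (V : lmodType E) (f : {linear A -> V | iota \; *:%R}) x y :
  ev f (rep (add x y)) = ev f (rep x) + ev f (rep y).
Proof. by rewrite rep_cls ev_cat. Qed.
Let evN (V : lmodType E) (f : {linear A -> V | iota \; *:%R}) x :
  ev f (rep (opp x)) = - ev f (rep x).
Proof. by rewrite rep_cls ev_sc scaleN1r. Qed.
Let ev0 (V : lmodType E) (f : {linear A -> V | iota \; *:%R}) : ev f (rep zero) = 0.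
Proof. by rewrite rep_cls /ev big_nil. Qed.
Let evZ (V : lmodType E) (f : {linear A -> V | iota \; *:%R}) k x :
  ev f (rep (scal k x)) = k *: ev f (rep x).
Proof. by rewrite rep_cls ev_sc. Qed.

Let addA : associative add.
Proof. by move=> x y z; apply: tP => V f; rewrite !evD addrA. Qed.
Let addC : commutative add.
Proof. by move=> x y; apply: tP => V f; rewrite !evD addrC. Qed.
Let add0 : left_id zero add.
Proof. by move=> x; apply: tP => V f; rewrite evD ev0 add0r. Qed.
Let addN : left_inverse zero opp add.
Proof. by move=> x; apply: tP => V f; rewrite evD evN ev0 addNr. Qed.
HB.instance Definition _ := GRing.isZmodule.Build tens addA addC add0 addN.

Let scalA a b v : scal a (scal b v) = scal (a * b) v.
Proof. by apply: tP => V f; rewrite !evZ scalerA. Qed.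
Let scal1 : left_id 1 scal.
Proof. by move=> x; apply: tP => V f; rewrite evZ scale1r. Qed.
Let scalDr : right_distributive scal +%R.
Proof. by move=> k x y; apply: tP => V f; rewrite !(evZ, evD) scalerDr. Qed.
Let scalDl v : {morph scal^~ v : a b / a + b}.
Proof. by move=> a b; apply: tP => V f; rewrite !(evZ, evD) scalerDl. Qed.
HB.instance Definition _ :=
  GRing.Zmodule_isLmodule.Build E tens scalA scal1 scalDr scalDl.

Let ten (x : A) : tens := cls [:: (1, x)].
Let ev_ten (V : lmodType E) (f : {linear A -> V | iota \; *:%R}) x : ev f (rep (ten x)) = f x.
Proof. by rewrite rep_cls /ev big_seq1 scale1r. Qed.
Fact ten_linear : linear_for (iota \; *:%R) ten.
Proof.
move=> k x y; apply: tP => V f.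
by rewrite evD evZ !ev_ten linearP.
Qed.
HB.instance Definition _ := GRing.isLinear.Build F A tens _ ten ten_linear.

Section Lift.
Variables (V : lmodType E) (f : {linear A -> V | iota \; *:%R}).
Definition tlift (x : tens) : V := ev f (rep x).
Fact tlift_linear : linear tlift.
Proof. by move=> k x y; rewrite /tlift evD evZ. Qed.
HB.instance Definition _ := GRing.isLinear.Build E tens V _ tlift tlift_linear.
Lemma tlift_ten x : tlift (ten x) = f x. Proof. exact: ev_ten. Qed.
End Lift.

Let cls_sum s : cls s = \sum_(p <- s) p.1 *: ten p.2.
Proof.
elim: s => [|p s IH]; first by rewrite big_nil.
rewrite big_cons -IH; apply: tP => V f.
by rewrite evD evZ ev_ten !rep_cls /ev big_cons.
Qed.

Lemma tens_ext (V : lmodType E) (g h : {linear tens -> V}) :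
  (forall x, g (ten x) = h (ten x)) -> g =1 h.
Proof.
move=> gh x; rewrite -(cls_rep x) cls_sum !linear_sum.
by apply: eq_bigr => p _; rewrite !linearZ /= gh.
Qed.

Variable mul : {bilinear A -> A -> A}.

Definition inner (x : A) (y : A) : tens := ten (mul x y).
Fact inner_linear x : linear_for (iota \; *:%R) (inner x).
Proof. by move=> k y z; rewrite /inner linearP linearP. Qed.
HB.instance Definition _ x :=
  GRing.isLinear.Build F A tens _ (inner x) (inner_linear x).

Definition outer (t : tens) (x : A) : tens := tlift (inner x) t.
Fact outer_linear t : linear_for (iota \; *:%R) (outer t).
Proof.
move=> k x y; rewrite /outer -(cls_rep t) cls_sum !linear_sum /=.
rewrite scaler_sumr -big_split; apply: eq_bigr => p _ /=.
rewrite !linearZ /= !tlift_ten /= /inner.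
rewrite linearPl linearP /=.
by rewrite scalerDr !scalerA mulrC.
Qed.
HB.instance Definition _ t :=
  GRing.isLinear.Build F A tens _ (outer t) (outer_linear t).

Definition tmul (s t : tens) : tens := tlift (outer t) s.
Fact tmul_bilinear : bilinear_for *:%R *:%R tmul.
Proof.
split=> [t k x y|s k x y]; first by rewrite /tmul /= linearP.
rewrite /tmul -(cls_rep s) cls_sum !linear_sum /=.
rewrite scaler_sumr -big_split; apply: eq_bigr => p _ /=.
rewrite !linearZ /= !tlift_ten /= /outer linearP /=.
by rewrite scalerDr !scalerA mulrC.
Qed.
HB.instance Definition _ :=
  bilinear_isBilinear.Build E tens tens tens _ _ tmul tmul_bilinear.

Lemma base_change_exists :
  exists (AE : lmodType E) (mulE : {bilinear AE -> AE -> AE})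
    (j : {linear A -> AE | iota \; *:%R}), base_change mul mulE j.
Proof.
exists tens, tmul, ten; split=> [x y|V f].
  rewrite -[LHS]/(tlift (outer (ten y)) (ten x)) tlift_ten.
  exact: tlift_ten.
split; first by exists (tlift f) => x; exact: tlift_ten.
by move=> g h gf hf; apply: tens_ext => x; rewrite gf hf.
Qed.

End BaseChangeExists.

Definition algebraic_closure (F : fieldType) (E : closedFieldType)
    (iota : {rmorphism F -> E}) : Prop :=
  forall e : E, algebraicOver iota e.

(* [B] is a subalgebra of A; as F is a field, B (x)_F E is identified with the
   E-span of the image of B in A (x)_F E. *)
Definition solid (F : fieldType) (A : lmodType F)
    (mul : {bilinear A -> A -> A}) (B : set A) : Prop :=
  forall (E : closedFieldType) (iota : {rmorphism F -> E}),
    algebraic_closure iota ->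
  forall (AE : lmodType E) (mulE : {bilinear AE -> AE -> AE})
         (j : {linear A -> AE | iota \; *:%R}),
    base_change mul mulE j ->
  forall c : AE,
    primitive_idempotent mulE (span [set j x | x in B]) c ->
    jordan_axis mulE c.

(* Main.v *)
(** For an idempotent c with (c, c) = 1, being a primitive axis amounts to the
    two families of identities [spectral] and [fusion], which are quadratic in
    c. The primitive idempotents of the algebra generated by two axes a and b
    lie on a conic in a plane: with s = ab - (a + b)/2 and c = xa + yb + zs,
    the conic is x + y + 2pz = 1, 2xy = pz^2 + (x + y)z, where p = ((a, b) - 1)/2
    is the scalar by which s acts.
    The Miyamoto involutions of a and b produce five axes on this conic. When
    m = 4(a, b) - 2 satisfies m <> 0 and m + 1 <> 0, a quadratic map vanishing
    at these five axes vanishes on the conic, so all its points are axes. The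
    condition m + 1 <> 0 is the exclusion of (a, b) = 1/4. If m = 0 there are
    only four axes, and the remaining coefficient is killed by combining the
    involutions of a and b with the spectral identities. Degenerate algebras of
    dimension at most two are treated directly. Everything is carried out over
    an arbitrary extension field, to which the Frobenius form extends; its
    algebraic closedness plays no role. *)
From HB Require Import structures.
Require Import Defs.
From mathcomp Require Import all_boot all_algebra.
From mathcomp Require Import boolp classical_sets ring.

Set Implicit Arguments.
Unset Strict Implicit.
Unset Printing Implicit Defensive.

Import GRing.Theory.

Local Open Scope classical_set_scope.
Local Open Scope ring_scope.

(** * Linear identities in a module, decided coefficient by coefficient *)

Section LinearNormalization.
Variables (K : fieldType) (V : lmodType K).

Inductive lexpr :=
  | LZero
  | LVar of nat
  | LAdd of lexpr & lexpr
  | LOpp of lexpr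
  | LScale of K & lexpr.

Fixpoint leval (env : seq V) (e : lexpr) : V :=
  match e with
  | LZero => 0
  | LVar i => nth 0 env i
  | LAdd e1 e2 => leval env e1 + leval env e2
  | LOpp e1 => - leval env e1
  | LScale k e1 => k *: leval env e1
  end.

Fixpoint lcoef (i : nat) (e : lexpr) : K :=
  match e with
  | LZero => 0
  | LVar j => if Nat.eqb i j then 1 else 0
  | LAdd e1 e2 => lcoef i e1 + lcoef i e2
  | LOpp e1 => - lcoef i e1
  | LScale k e1 => k * lcoef i e1
  end.

(** Recursion on [n] makes this unfold, for a concrete environment, into one scalar equation per
    atom, ready for [ring] or [field]. *)
Fixpoint same_coefs (n : nat) (e1 e2 : lexpr) : Prop :=
  if n is n'.+1 then lcoef n' e1 = lcoef n' e2 /\ same_coefs n' e1 e2 else True.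

Lemma leval_coef (env : seq V) (e : lexpr) :
  leval env e = \sum_(i < size env) lcoef i e *: nth 0 env i.
Proof.
elim: e => [|j|e1 IH1 e2 IH2|e1 IH|k e1 IH] /=.
- by rewrite big1 // => i _; rewrite scale0r.
- have eqbE i : Nat.eqb i j = (i == j :> nat).
    by apply/idP/eqP => [/PeanoNat.Nat.eqb_eq|->] //; rewrite PeanoNat.Nat.eqb_refl.
  have [lt_j|le_j] := ltnP j (size env).
    rewrite (bigD1 (Ordinal lt_j)) //= eqbE eqxx scale1r big1 ?addr0 // => i.
    by rewrite -val_eqE /= eqbE => /negPf->; rewrite scale0r.
  rewrite nth_default // big1 // => i _; rewrite eqbE.
  by rewrite ltn_eqF ?scale0r // (leq_trans _ le_j).
- by rewrite IH1 IH2 -big_split /=; apply: eq_bigr => i _; rewrite scalerDl.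
- by rewrite IH -sumrN; apply: eq_bigr => i _; rewrite scaleNr.
- by rewrite IH scaler_sumr; apply: eq_bigr => i _; rewrite scalerA.
Qed.

Lemma leval_eq (env : seq V) (e1 e2 : lexpr) :
  same_coefs (size env) e1 e2 -> leval env e1 = leval env e2.
Proof.
rewrite !leval_coef => same; apply: eq_bigr => -[i lt_i] _ /=; congr (_ *: _).
elim: (size env) same lt_i => // n IH /= [eq_n same].
by rewrite ltnS leq_eqVlt => /predU1P[->|/(IH same)].
Qed.

End LinearNormalization.

Ltac atom_index env x :=
  match env with
  | ?y :: _ => let _ := match goal with _ => unify x y end in constr:(0%nat)
  | _ :: ?env' => let i := atom_index env' x in constr:(S i)
  end.

Ltac add_atom env x :=
  match env with
  | _ => let i := atom_index env x in env
  | _ => constr:(x :: env)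
  end.

Ltac collect_atoms env e :=
  lazymatch e with
  | @GRing.zero _ => env
  | @GRing.add _ ?x ?y => let env' := collect_atoms env x in collect_atoms env' y
  | @GRing.opp _ ?x => collect_atoms env x
  | @GRing.scale _ _ _ ?x => collect_atoms env x
  | _ => add_atom env e
  end.

Ltac reify_linear K env e :=
  lazymatch e with
  | @GRing.zero _ => constr:(LZero K)
  | @GRing.add _ ?x ?y =>
      let e1 := reify_linear K env x in let e2 := reify_linear K env y in
      constr:(LAdd e1 e2)
  | @GRing.opp _ ?x => let e1 := reify_linear K env x in constr:(LOpp e1)
  | @GRing.scale _ _ ?k ?x =>
      let e1 := reify_linear K env x in constr:(LScale k e1)
  | _ => let i := atom_index env e in constr:(LVar K i)
  end.

(* Atoms are the maximal subterms not built from [0], [+], [-] and [*:]; they are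
   identified up to unification, since equal terms may display different
   structure instances. *)
Ltac module_over K :=
  lazymatch goal with
  | |- @eq ?T ?x ?y =>
      let env0 := collect_atoms (@nil T) x in
      let env := collect_atoms env0 y in
      let e1 := reify_linear K env x in
      let e2 := reify_linear K env y in
      apply: (@leval_eq K _ env e1 e2);
      cbn [same_coefs lcoef size Nat.eqb]; repeat split;
      first [ring | solve [field; repeat (apply/andP; split); assumption]]
  end.

(** Uses a known equation [l = r] with multiplier [k]: the goal becomes an identity that holds
    coefficientwise, which [module_over] settles. *)
Lemma cancel_eq (K : fieldType) (V : lmodType K) (l r : V) :
  l = r -> forall (k : K) (x y : V), x + k *: l = y + k *: r -> x = y.
Proof. by move=> -> k x y; apply: addIr. Qed.
Arguments cancel_eq [K V l r] _ k [x y] _.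

Definition bilinE := (linearDl, linearDr, linearNl, linearNr, linearZl_LR,
  linearZr_LR, linear0l, linear0r).

(** * Axes and quadratic identities *)

Section Axes.
Variables (K : fieldType) (A : lmodType K).
Variables (mul : {bilinear A -> A -> A}) (form : {biscalar A}).
Hypothesis two : 2 != 0 :> K.
Hypothesis mulC : commutative mul.
Hypothesis formC : forall x y, form x y = form y x.
Hypothesis frob : frobenius mul form.

Local Notation "x ** y" := (mul x y) (at level 40, left associativity).

(* Quadratic identities in [c], equivalent for an idempotent with [(c, c) = 1]
   to being a primitive axis. *)
Definition spectral (c x : A) : Prop :=
  2 *: (c ** (c ** x)) = c ** x + form c x *: c.

(** For an idempotent [c] satisfying [spectral], four times this identity says that [reflection c]
    preserves the product [x ** y]. *)
Definition fusion (c x y : A) : Prop :=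
  4 *: ((c ** x) ** (c ** y)) =
  - (c ** (x ** y)) + form c (x ** y) *: c + x ** (c ** y) + y ** (c ** x)
  + form c x *: (c ** y) + form c y *: (c ** x).

Definition axis (c : A) : Prop :=
  [/\ c ** c = c, form c c = 1, forall x, spectral c x &
      forall x y, fusion c x y].

Lemma spectralE (c : A) : axis c -> forall x,
  c ** (c ** x) = 2^-1 *: (c ** x) + (form c x / 2) *: c.
Proof.
case=> _ _ cG _ x; apply: (cancel_eq (cG x) (- 2^-1)); module_over K.
Qed.

Lemma axis_form_mul (c : A) : axis c -> forall x, form c (c ** x) = form c x.
Proof. by case=> cc _ _ _ x; rewrite frob cc. Qed.

(** The element [z - k *: a] is annihilated by [a], and multiplication by such an element preserves
    the eigenspaces of [a]. In formulas, [fusion a x z] collapses to the claim once [spectral] is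
    applied. *)
Lemma axis_commute (a z : A) (k : K) : axis a -> a ** z = k *: a ->
  forall x, z ** (a ** x) = a ** (z ** x).
Proof.
move=> axis_a az x; have [aa fa _ /(_ x z) aH] := axis_a.
have faz : form a z = k by rewrite -axis_form_mul // az !bilinE /= fa mulr1.
have fazx : form a (x ** z) = k * form a x.
  by rewrite (mulC x) frob az !bilinE.
move: aH; rewrite /fusion az fazx faz !bilinE /=.
rewrite (mulC (a ** x) a) (spectralE axis_a) (mulC x a) (mulC x z) => aH.
apply: (cancel_eq aH 1); module_over K.
Qed.

(** * Miyamoto involutions *)

Section Reflection.
Variable a : A.
Hypothesis axis_a : axis a.

(** The Miyamoto involution of [a]: it fixes the eigenspaces for 1 and 0 and negates the one for
    1/2. *)
Definition reflection (x : A) : A := x - 4 *: (a ** x) + (4 * form a x) *: a.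
Local Notation t := reflection.

Lemma reflectionP (k : K) (x y : A) : t (k *: x + y) = k *: t x + t y.
Proof. rewrite /t !bilinE /=; module_over K. Qed.
Lemma reflectionD (x y : A) : t (x + y) = t x + t y.
Proof. by rewrite -[x in LHS]scale1r reflectionP scale1r. Qed.
Lemma reflectionZ (k : K) (x : A) : t (k *: x) = k *: t x.
Proof. rewrite /t !bilinE /=; module_over K. Qed.
Lemma reflectionN (x : A) : t (- x) = - t x.
Proof. by rewrite -!scaleN1r reflectionZ. Qed.

Lemma reflectionK : involutive t.
Proof.
move=> x; have [aa fa _ _] := axis_a.
rewrite /t !bilinE /= !(spectralE axis_a, axis_form_mul axis_a, aa, fa).
module_over K.
Qed.

Lemma reflection_mul (x y : A) : t (x ** y) = t x ** t y.
Proof.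
have [aa fa _ /(_ x y) aH] := axis_a.
rewrite /t !bilinE /= (mulC x a) (mulC (a ** x) y) (mulC (a ** x) a).
rewrite !(spectralE axis_a) aa; apply: (cancel_eq aH 4); module_over K.
Qed.

Lemma reflection_form (x y : A) : form (t x) (t y) = form x y.
Proof.
have [aa fa _ _] := axis_a.
have -> : form (t x) (t y) = form x y - 4 * form x (a ** y)
    + 4 * form a y * form x a - 4 * form (a ** x) y
    + 16 * form (a ** x) (a ** y) - 16 * form a y * form (a ** x) a
    + 4 * form a x * form a y - 16 * form a x * form a (a ** y)
    + 16 * form a x * form a y * form a a.
  by rewrite /t !bilinE /=; ring.
rewrite (mulC a x) -!frob (spectralE axis_a) !bilinE /= aa fa.
rewrite axis_form_mul // (formC x a); field; exact: two.
Qed.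

(** The involution is an isometric automorphism, so the identities of [c] at the preimages of [x]
    and [y] are carried to those of [t c]. *)
Lemma reflection_axis (c : A) : axis c -> axis (t c).
Proof.
case=> cc fc cG cH; split=> [||x|x y].
- by rewrite -reflection_mul cc.
- by rewrite reflection_form.
- rewrite -(reflectionK x) /spectral -!reflection_mul reflection_form.
  by rewrite -!reflectionZ -reflectionD cG.
- rewrite -(reflectionK x) -(reflectionK y) /fusion -!reflection_mul.
  rewrite !reflection_form -!reflectionZ -reflectionN -!reflectionD.
  by rewrite cH (reflection_mul x y).
Qed.

End Reflection.

Lemma axis_jordan (c : A) : axis c -> jordan_axis mul c.
Proof.
move=> axis_c; have [cc fc cG cH] := axis_c.
have ccx := spectralE axis_c.
have eig1 x : c ** x = 1 *: x -> x = form c x *: c.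
  rewrite scale1r => cx; have := cG x; rewrite /spectral !cx => e.
  by apply: (cancel_eq e (-1)); module_over K.
have form0 x : c ** x = 0 *: x -> form c x = 0.
  by move=> cx; rewrite -(axis_form_mul axis_c) cx scale0r !bilinE.
have formh x : c ** x = 2^-1 *: x -> form c x = 0.
  move=> cx; have := axis_form_mul axis_c x; rewrite cx !bilinE /= => e.
  have -> : form c x = 2 * (form c x - 2^-1 * form c x) by field; exact: two.
  by rewrite e subrr mulr0.
split=> //.
- by move=> c0; move: fc; rewrite c0 !bilinE => /eqP; rewrite eq_sym oner_eq0.
(* By [spectral], [2 *: c] acts as a projection on x' = x - (c, x)c. The components for 1, 0 and 1/2
   are therefore (c, x)c, x' - 2cx' and 2cx'. *)
- move=> x; exists ((form c x *: c, x + form c x *: c - 2 *: (c ** x)),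
                    2 *: (c ** x) - (2 * form c x) *: c); split.
    split; rewrite /Defs.eigenspace /= ?bilinE /= ?cc ?ccx; module_over K.
  move=> [[y1 y0] yh] [/= c1 c0 ch xE].
  have y1E : y1 = form c x *: c.
    rewrite [LHS](eig1 _ c1) xE !bilinE /= (form0 _ c0) (formh _ ch) !addr0.
    by [].
  have cxE : c ** x = y1 + 2^-1 *: yh.
    by rewrite xE !bilinE /= c1 c0 ch; module_over K.
  by rewrite -scalerA -y1E cxE xE; congr (_, _, _); module_over K.
(* The rules with a factor in the 1-eigenspace follow from that space being the line of [c]. The
   other three are [fusion] at eigenvectors, where it determines [c ** (x ** y)]. *)
split; split.
- move=> _ [x cx [y cy <-]]; rewrite (eig1 _ cx) (eig1 _ cy).
  by rewrite /Defs.eigenspace /= !bilinE /= !cc; module_over K.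
- move=> _ [x cx [y cy <-]]; have := cH x y; rewrite /fusion /Defs.eigenspace /=.
  rewrite cx cy (frob c x y) cx (form0 _ cx) !scale0r !bilinE /= => e.
  by apply: (cancel_eq e (-1)); module_over K.
- move=> _ [x cx [y cy <-]]; rewrite (eig1 _ cx) /= !bilinE /= cy.
  by module_over K.
- move=> _ [x cx [y cy <-]]; rewrite (eig1 _ cx).
  by rewrite /Defs.eigenspace /= !bilinE /= cy !bilinE /= cy; module_over K.
- move=> _ [x cx [y cy <-]]; have := cH x y; rewrite /fusion /Defs.eigenspace /=.
  rewrite cx cy (frob c x y) cx (form0 _ cx) (formh _ cy) !scale0r !bilinE /= => e.
  by apply: (cancel_eq e (-1)); module_over K.
- move=> _ [x cx [y cy <-]]; have := cH x y; rewrite /fusion /=.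
  rewrite cx cy (formh _ cx) (formh _ cy) !bilinE /= (mulC y x) => e.
  have cxy : c ** (x ** y) = form c (x ** y) *: c.
    by apply: (cancel_eq e (-1)); module_over K.
  exists (form c (x ** y) *: c).
    by rewrite /Defs.eigenspace /= !bilinE /= cc scale1r.
  exists (x ** y - form c (x ** y) *: c); last by rewrite addrC subrK.
  by rewrite /Defs.eigenspace /= !bilinE /= cc cxy; module_over K.
Qed.

(** Both identities are linear in [x] and [y], so they are checked on components. Primitivity and
    the orthogonality of [c] to its 0- and 1/2-eigenspaces make the 1-component of [x] equal to (c,
    x)c. *)
Lemma jordan_axis_axis (c : A) :
  primitive_jordan_axis mul c -> form c c = 1 -> axis c.
Proof.
move=> [[c0 cc dec [[_ A00 A10] [_ A0h Ahh]]] A1] fc.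
have form0 x : c ** x = 0 -> form c x = 0.
  by move=> cx; rewrite -[c in form c _]cc -frob cx !bilinE.
have formh x : c ** x = 2^-1 *: x -> form c x = 0.
  move=> cx; have := frob c c x; rewrite cc cx !bilinE /= => e.
  have -> : form c x = 2 * (form c x - 2^-1 * form c x) by field; exact: two.
  by rewrite e subrr mulr0.
have {dec}dec x : exists x0 xh, [/\ c ** x0 = 0, c ** xh = 2^-1 *: xh &
    x = form c x *: c + x0 + xh].
  have [[[x1 x0] xh] [[/= cx1 cx0 cxh xE] _]] := dec x.
  have : line c x1 by rewrite -A1.
  move=> [k _ kE]; have {}cx0 : c ** x0 = 0 by rewrite cx0 scale0r.
  exists x0, xh; split=> //.
  rewrite [in form c x]xE -kE !bilinE /= fc (form0 _ cx0) (formh _ cxh) mulr1 !addr0.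
  by rewrite kE.
split=> // [x|x y].
  have [x0 [xh [cx0 cxh]]] := dec x; move: (form c x) => k xE.
  have fx : form c x = k by rewrite xE !bilinE /= fc form0 // formh // mulr1 !addr0.
  rewrite /spectral fx xE !bilinE /= !cc cx0 cxh !bilinE /= cxh.
  by module_over K.
have [x0 [xh [cx0 cxh]]] := dec x; move: (form c x) => k xE.
have [y0 [yh [cy0 cyh]]] := dec y; move: (form c y) => l yE.
have fx : form c x = k by rewrite xE !bilinE /= fc form0 // formh // mulr1 !addr0.
have fy : form c y = l by rewrite yE !bilinE /= fc form0 // formh // mulr1 !addr0.
have cx0y0 : c ** (x0 ** y0) = 0.
  rewrite -(scale0r (x0 ** y0)); apply: A00.
  by exists x0; [|exists y0]; rewrite /Defs.eigenspace /= ?scale0r.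
have cx0yh : c ** (x0 ** yh) = 2^-1 *: (x0 ** yh).
  by apply: A0h; exists x0; [|exists yh]; rewrite /Defs.eigenspace /= ?scale0r.
have cy0xh : c ** (y0 ** xh) = 2^-1 *: (y0 ** xh).
  by apply: A0h; exists y0; [|exists xh]; rewrite /Defs.eigenspace /= ?scale0r.
have cxhyh : c ** (xh ** yh) = form c (xh ** yh) *: c.
  have [z1 Az1 [z0 Az0 <-]] : sumset (Defs.eigenspace mul 1 c)
      (Defs.eigenspace mul 0 c) (xh ** yh) by apply: Ahh; exists xh => //; exists yh.
  have : line c z1 by rewrite -A1.
  move=> [r _ <-]; have {}Az0 : c ** z0 = 0 by rewrite Az0 scale0r.
  by rewrite !bilinE /= cc fc Az0 form0 // mulr1 !addr0.
have f0 z z' : c ** z = 0 -> form c (z ** z') = 0 by move=> cz; rewrite frob cz !bilinE.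
rewrite /fusion fx fy xE yE !bilinE /=.
rewrite ?(mulC x0 c) ?(mulC xh c) ?(mulC yh c) ?(mulC y0 c).
rewrite ?(mulC xh y0) !(cc, cx0, cxh, cy0, cyh, fc) !bilinE /=.
rewrite ?(mulC xh c) ?(mulC x0 c) ?(mulC y0 c) ?(mulC yh c).
rewrite !(cc, cx0, cxh, cy0, cyh, fc) (mulC yh xh).
rewrite cx0y0 cx0yh cy0xh cxhyh (f0 x0 y0) // (f0 x0 yh) // (f0 y0 xh) //.
rewrite (formh _ cxh) (formh _ cyh).
module_over K.
Qed.

(** * The plane of two axes *)

Section Plane.
Variables a b : A.
Hypotheses (axis_a : axis a) (axis_b : axis b).

(* Locked, since otherwise rewriting with bilinearity unfolds it. *)
Definition sig : A := locked (a ** b - 2^-1 *: (a + b)).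
Local Notation phi := (form a b).
Local Notation p := ((phi - 1) / 2).
Local Notation m := (4 * phi - 2).
Local Notation s := sig.

Lemma mul_ab : a ** b = s + 2^-1 *: a + 2^-1 *: b.
Proof. rewrite /s -lock; module_over K. Qed.

Lemma mul_a_sig : a ** s = p *: a.
Proof.
have [aa _ _ _] := axis_a.
rewrite /s -lock !bilinE /= aa (spectralE axis_a); module_over K.
Qed.

Lemma mul_b_sig : b ** s = p *: b.
Proof.
have [bb _ _ _] := axis_b.
rewrite /s -lock !bilinE /= bb mulC (mulC a b) -/(mul b a) [_ ** b]mulC.
rewrite (spectralE axis_b) (formC b a); module_over K.
Qed.

(** As [a ** s] is a multiple of [a], multiplication by [s] commutes with multiplication by [a].
    Hence s(ab) = a(sb) = p ab, and expanding ab = s + a/2 + b/2 leaves the value of ss. *)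
Lemma mul_sig_sig : s ** s = p *: s.
Proof.
have [aa fa _ _] := axis_a; have [bb fb _ _] := axis_b.
have sab := axis_commute axis_a mul_a_sig b.
have : s ** (a ** b) = p *: (a ** b).
  by rewrite sab (mulC s) mul_b_sig !bilinE.
rewrite mul_ab; move: (mul_a_sig) (mul_b_sig) => as_ bs_.
move: s as_ bs_ {sab} => z az bz.
rewrite !bilinE /= !(mulC z _) az bz => e.
apply: (cancel_eq e (-1)); module_over K.
Qed.

Lemma form_a_sig : form a s = p.
Proof.
have [_ fa _ _] := axis_a.
by rewrite -axis_form_mul // mul_a_sig !bilinE /= fa mulr1.
Qed.

Lemma form_b_sig : form b s = p.
Proof.
have [_ fb _ _] := axis_b.
by rewrite -axis_form_mul // mul_b_sig !bilinE /= fb mulr1.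
Qed.

Lemma form_sig_sig : form s s = 2 * p ^+ 2.
Proof.
have : form s (a ** b) = p * phi by rewrite frob (mulC s) mul_a_sig !bilinE.
rewrite mul_ab !bilinE /= !(formC s) form_a_sig form_b_sig => e.
have -> : form s s = (form s s + 2^-1 * p + 2^-1 * p) - p by field.
rewrite e; field; exact: two.
Qed.

Definition point (x y z : K) : A := x *: a + y *: b + z *: s.
(** The linear form with value 1 at a and b and 2p at s; in coordinates, both reflections preserve
    it. *)
Definition weight (x y z : K) : K := x + y + (phi - 1) * z.

Lemma reflection_a_point (x y z : K) :
  reflection a (point x y z) = point (x + m * y) (- y) (z - 4 * y).
Proof.
have [aa fa _ _] := axis_a.
rewrite /reflection /point !bilinE /= aa mul_ab mul_a_sig form_a_sig fa.
module_over K.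
Qed.

Lemma reflection_b_point (x y z : K) :
  reflection b (point x y z) = point (- x) (y + m * x) (z - 4 * x).
Proof.
have [bb fb _ _] := axis_b.
rewrite /reflection /point !bilinE /= bb (mulC b a) mul_ab mul_b_sig.
rewrite form_b_sig fb (formC b a); module_over K.
Qed.

Section Conic.
(* [P] is a bilinear map on pairs [(c, l)], where [l] homogenizes polynomial
   maps of degree two on the plane [weight = 1]. *)
Variable P : A -> K -> A -> K -> A.
Hypothesis Pl : forall k u r u' r' v q,
  P (k *: u + u') (k * r + r') v q = k *: P u r v q + P u' r' v q.
Hypothesis Pr : forall k u r v q v' q',
  P u r (k *: v + v') (k * q + q') = k *: P u r v q + P u r v' q'.
Hypothesis P_axis : forall c, axis c -> P c 1 c 1 = 0.

(** These are the coefficients of z^2, xy, xz and yz in the quadratic map of [P]; those of x^2 and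
    y^2 vanish because a and b are axes. *)
Let q3 := P s (phi - 1) s (phi - 1).
Let q12 := P a 1 b 1 + P b 1 a 1.
Let q13 := P a 1 s (phi - 1) + P s (phi - 1) a 1.
Let q23 := P b 1 s (phi - 1) + P s (phi - 1) b 1.

Let Pl_point (x y z : K) v q :
  P (point x y z) (weight x y z) v q =
  x *: P a 1 v q + y *: P b 1 v q + z *: P s (phi - 1) v q.
Proof.
have -> : point x y z = x *: a + (y *: b + z *: s) by rewrite addrA.
have -> : weight x y z = x * 1 + (y * 1 + z * (phi - 1)) by rewrite /weight; ring.
have P0 : P 0 0 v q = 0.
  have := Pl (-1) 0 0 0 0 v q.
  by rewrite scaler0 mulr0 !addr0 scaleN1r addNr.
have := Pl z s (phi - 1) 0 0 v q; rewrite P0 !addr0 => Ps.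
by rewrite !Pl Ps addrA.
Qed.

Let P_point (x y z : K) :
  P (point x y z) (weight x y z) (point x y z) (weight x y z) =
  (z ^+ 2) *: q3 + (x * y) *: q12 + (x * z) *: q13 + (y * z) *: q23.
Proof.
have Pr_point u r : P u r (point x y z) (weight x y z) =
    x *: P u r a 1 + y *: P u r b 1 + z *: P u r s (phi - 1).
  have -> : point x y z = x *: a + (y *: b + z *: s) by rewrite addrA.
  have -> : weight x y z = x * 1 + (y * 1 + z * (phi - 1)) by rewrite /weight; ring.
  have Pr0 : P u r 0 0 = 0.
    have := Pr (-1) u r 0 0 0 0.
    by rewrite scaler0 mulr0 !addr0 scaleN1r addNr.
  have := Pr z u r s (phi - 1) 0 0; rewrite Pr0 !addr0 => Prs.
  by rewrite !Pr Prs addrA.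
rewrite Pl_point !Pr_point !P_axis // /q3 /q12 /q13 /q23; module_over K.
Qed.

Let P_point_axis (x y z : K) : axis (point x y z) -> weight x y z = 1 ->
  (z ^+ 2) *: q3 + (x * y) *: q12 + (x * z) *: q13 + (y * z) *: q23 = 0.
Proof. by move=> axis_pt w1; rewrite -P_point w1 P_axis. Qed.

(** Besides a and b, the axes used are c1, the image of b under the involution of a, c2, the image
    of a under that of b, and c3, the image of c2 under that of a. *)
Let axis_c1 : axis (point m (-1) (- 4)).
Proof.
have b_pt : b = point 0 1 0 by rewrite /point; module_over K.
have := reflection_axis axis_a axis_b.
rewrite [X in reflection a X]b_pt reflection_a_point.
by congr (axis (point _ _ _)); ring.
Qed.

Let axis_c2 : axis (point (-1) m (- 4)).
Proof.
have a_pt : a = point 1 0 0 by rewrite /point; module_over K.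
have := reflection_axis axis_b axis_a.
rewrite [X in reflection b X]a_pt reflection_b_point.
by congr (axis (point _ _ _)); ring.
Qed.

Let axis_c3 : axis (point (m ^+ 2 - 1) (- m) (- 4 * (m + 1))).
Proof.
have := reflection_axis axis_a axis_c2.
rewrite reflection_a_point; congr (axis (point _ _ _)); ring.
Qed.

(** The plane has collapsed to the line through a and b, on which the quadratic map is xy [q12]. The
    axis c1 = 2a - b has xy = -2, which kills [q12]. *)
Lemma conic_line (x y : K) : phi = 1 -> s = 0 -> x + y = 1 ->
  P (x *: a + y *: b) 1 (x *: a + y *: b) 1 = 0.
Proof.
move=> phi1 s0 xy1.
have pt0 u v : point u v 0 = u *: a + v *: b by rewrite /point s0; module_over K.
have ptE u v z : point u v z = point u v 0 by rewrite /point s0; module_over K.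
have := axis_c1; rewrite ptE => /P_point_axis e.
have {}e : q12 = 0.
  have w1 : weight m (-1) 0 = 1 by rewrite /weight phi1; ring.
  apply: (scalerI two); apply: (cancel_eq (e w1) 1); rewrite phi1; module_over K.
have w1 : weight x y 0 = 1 by rewrite /weight mulr0 addr0.
rewrite -pt0 -w1 P_point e; module_over K.
Qed.

Hypothesis m1 : m + 1 != 0.

(** The equations at c1 and c2 differ by 4(m + 1)([q23] - [q13]). *)
Let q23E : q23 = q13.
Proof.
have /P_point_axis e1 := axis_c1; have /P_point_axis e2 := axis_c2.
apply: (scalerI m1).
have {}e1 := e1 _; have {}e2 := e2 _.
apply: (cancel_eq (e1 _) (- 4^-1)); first by rewrite /weight; ring.
apply: (cancel_eq (e2 _) (4^-1)); first by rewrite /weight; ring.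
have four : 4 != 0 :> K by rewrite (natrM _ 2 2) mulf_neq0.
module_over K.
Qed.

Let q3E : 16 *: q3 = m *: q12 + (4 * (m - 1)) *: q13.
Proof.
have /P_point_axis e1 := axis_c1.
apply: (cancel_eq (e1 _) (-1)); first by rewrite /weight; ring.
rewrite q23E; module_over K.
Qed.

(** The axes c1 and c2 eliminate [q3] and [q23], and the conic eliminates (x + y)z; one unknown
    coefficient remains. *)
Let P_conic (x y z : K) :
  2 * x * y = p * z ^+ 2 + (x + y) * z ->
  P (point x y z) (weight x y z) (point x y z) (weight x y z) =
  (x * y + m * z ^+ 2 / 16) *: (q12 + 2 *: q13).
Proof.
move=> xyz; rewrite P_point q23E.
have sixteen : 16 != 0 :> K by rewrite (natrM _ 4 4) (natrM _ 2 2) !mulf_neq0.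
apply: (cancel_eq q3E (- (z ^+ 2 / 16))).
have -> : (x * z) *: q13 = (2 * x * y - p * z ^+ 2 - y * z) *: q13.
  by congr (_ *: _); rewrite xyz; ring.
module_over K.
Qed.

Lemma conic_vanish (x y z : K) : m != 0 ->
  2 * x * y = p * z ^+ 2 + (x + y) * z ->
  P (point x y z) (weight x y z) (point x y z) (weight x y z) = 0.
Proof.
move=> m0 xyz; rewrite P_conic //.
have /P_point_axis e3 := axis_c3.
have w3 : weight (m ^+ 2 - 1) (- m) (- 4 * (m + 1)) = 1 by rewrite /weight; ring.
suff -> : q12 + 2 *: q13 = 0 by rewrite scaler0.
(* At c3 the quadratic map takes the value 2m(m + 1)([q12] + 2[q13]). *)
have nz : 2 * m * (m + 1) != 0 by rewrite !mulf_neq0.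
apply: (scalerI nz); rewrite scaler0 -(e3 w3) q23E.
apply: (cancel_eq q3E ((m + 1) ^+ 2)); module_over K.
Qed.

(** When m = 0 the axis c3 coincides with c2. The surviving coefficient is rewritten as the
    symmetrized value of [P] at a + 2s and b + 2s, which have weight zero. *)
Lemma conic_half (x y z : K) : m = 0 ->
  2 * x * y = p * z ^+ 2 + (x + y) * z ->
  P (point x y z) (weight x y z) (point x y z) (weight x y z) =
  (x * y) *: (P (a + 2 *: s) 0 (b + 2 *: s) 0 + P (b + 2 *: s) 0 (a + 2 *: s) 0).
Proof.
move=> m0 xyz; rewrite P_conic // m0 mul0r mul0r addr0; congr (_ *: _).
have four : 4 != 0 :> K by rewrite (natrM _ 2 2) mulf_neq0.
have phiE : phi = 2^-1.
  have -> : phi = (m + 2) / 4 by field.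
  by rewrite m0; field; rewrite two four.
have w0 : 2 * (phi - 1) + 1 = 0 by rewrite phiE; field; exact: two.
have P0E u v : P (u + 2 *: s) 0 (v + 2 *: s) 0 =
    P (2 *: s + u) (2 * (phi - 1) + 1) (2 *: s + v) (2 * (phi - 1) + 1).
  by rewrite w0 ![_ + 2 *: s]addrC.
rewrite !P0E !Pl !Pr.
move: q3E; rewrite m0 => q3E'.
have {}q3E' : 8 *: q3 = - (2 *: q13).
  by apply: (scalerI two); rewrite scalerA -natrM q3E'; module_over K.
apply: (cancel_eq q3E' 1); apply: (cancel_eq q23E 2).
rewrite /q3 /q12 /q13 /q23; module_over K.
Qed.

End Conic.

End Plane.

(** * Orthogonal axes *)

Section UnitVector.
Variables o v : A.
Hypotheses (oo : o ** o = o) (ov : o ** v = v).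
Hypotheses (axis_p : axis (2^-1 *: o + v)) (axis_m : axis (2^-1 *: o - v)).

(** The axis o/2 + v is fixed by [o], so [axis_commute] applies with scalar 1. *)
Lemma unit_commute (x : A) : o ** (v ** x) = v ** (o ** x).
Proof.
have e : (2^-1 *: o + v) ** o = 1 *: (2^-1 *: o + v).
  by rewrite !bilinE /= oo (mulC v) ov scale1r.
have := axis_commute axis_p e x; rewrite !bilinE /= => c.
apply: (cancel_eq c (-1)); module_over K.
Qed.

(** This comes from the difference of the [spectral] identities of o/2 + v and o/2 - v; [unit_even]
    comes from their sum. *)
Lemma unit_odd (x : A) :
  2 *: (o ** (v ** x)) =
  v ** x + (form o x / 2) *: v + (form v x / 2) *: o.
Proof.
have [_ _ /(_ x) gp _] := axis_p; have [_ _ /(_ x) gm _] := axis_m.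
apply: (cancel_eq gp (- 2^-1)); apply: (cancel_eq gm 2^-1).
rewrite !bilinE /= -unit_commute; module_over K.
Qed.

Lemma unit_even (x : A) :
  4 *: (v ** (v ** x)) =
  o ** x - o ** (o ** x) + (form o x / 2) *: o + (2 * form v x) *: v.
Proof.
have [_ _ /(_ x) gp _] := axis_p; have [_ _ /(_ x) gm _] := axis_m.
apply: (cancel_eq gp (-1)); apply: (cancel_eq gm (-1)).
rewrite !bilinE /=; module_over K.
Qed.

End UnitVector.

(* The case [(a, b) = 1/2]: here [a = o/2 + v] and [b = o/2 + w] for the
   identity [o] of the subalgebra, and [v], [w] are orthogonal. *)
Section Orthogonal.
Variables o v w : A.
Hypotheses (oo : o ** o = o) (ov : o ** v = v) (ow : o ** w = w).
Hypotheses (vv : v ** v = 4^-1 *: o) (ww : w ** w = 4^-1 *: o) (vw : v ** w = 0).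
Hypotheses (foo : form o o = 2) (fov : form o v = 0) (fow : form o w = 0).
Hypotheses (fvv : form v v = 2^-1) (fww : form w w = 2^-1) (fvw : form v w = 0).
Hypotheses (axis_vp : axis (2^-1 *: o + v)) (axis_vm : axis (2^-1 *: o - v)).
Hypotheses (axis_wp : axis (2^-1 *: o + w)) (axis_wm : axis (2^-1 *: o - w)).

Let four : 4 != 0 :> K. Proof. by rewrite (natrM _ 2 2) mulf_neq0. Qed.
Let sixteen : 16 != 0 :> K. Proof. by rewrite (natrM _ 4 4) mulf_neq0. Qed.
Let ovC := unit_commute oo ov axis_vp.
Let owC := unit_commute oo ow axis_wp.
Let v_odd := unit_odd oo ov axis_vp axis_vm.
Let w_odd := unit_odd oo ow axis_wp axis_wm.
Let v_even := unit_even axis_vp axis_vm.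
Let w_even := unit_even axis_wp axis_wm.
Local Notation ta := (reflection (2^-1 *: o + v)).
Local Notation tb := (reflection (2^-1 *: o + w)).

(** The involution [ta] negates [w], hence sends wx to -w([ta] x). The statement is the vanishing of
    the tu-coefficient in the defect of [spectral] at o/2 + tv + uw. *)
Lemma orthogonal_spectral (x : A) :
  2 *: (v ** (w ** x)) + 2 *: (w ** (v ** x)) = form v x *: w + form w x *: v.
Proof.
have ta_w : ta w = - w.
  by rewrite /reflection !bilinE /= ow vw fow fvw; module_over K.
have fv_wx : form v (w ** x) = 0 by rewrite frob vw !bilinE.
have fo_wx : form o (w ** x) = form w x by rewrite frob ow.
have := reflection_mul axis_vp w x; rewrite ta_w.
rewrite /reflection !bilinE /= fv_wx fo_wx (mulC w o) ow (mulC w v) vw => e.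
apply: (cancel_eq e (2^-1)); rewrite -owC.
apply: (cancel_eq (w_odd x) 1); module_over K.
Qed.

Definition perp (x : A) : Prop := [/\ form o x = 0, form v x = 0 & form w x = 0].

Lemma perp_v (x : A) : perp x -> perp (v ** x).
Proof.
case=> ox vx wx; split; rewrite frob ?(mulC w) ?ov ?vv ?vw ?bilinE /= ?ox ?mulr0 //.
Qed.

Lemma perp_w (x : A) : perp x -> perp (w ** x).
Proof.
case=> ox vx wx; split; rewrite frob ?ow ?vw ?ww ?bilinE /= ?ox ?mulr0 //.
Qed.

Lemma perp_ov (x : A) : perp x -> o ** (v ** x) = 2^-1 *: (v ** x).
Proof.
case=> fo fv fw; apply: (cancel_eq (v_odd x) (- 2^-1)); rewrite fo fv.
module_over K.
Qed.

Lemma perp_ow (x : A) : perp x -> o ** (w ** x) = 2^-1 *: (w ** x).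
Proof.
case=> fo fv fw; apply: (cancel_eq (w_odd x) (- 2^-1)); rewrite fo fw.
module_over K.
Qed.

Lemma perp_vv (x : A) : perp x ->
  v ** (v ** x) = 4^-1 *: (o ** x - o ** (o ** x)).
Proof.
case=> fo fv fw; apply: (cancel_eq (v_even x) (- 4^-1)); rewrite fo fv.
module_over K.
Qed.

Lemma perp_ww (x : A) : perp x ->
  w ** (w ** x) = 4^-1 *: (o ** x - o ** (o ** x)).
Proof.
case=> fo fv fw; apply: (cancel_eq (w_even x) (- 4^-1)); rewrite fo fw.
module_over K.
Qed.

Lemma perp_wv (x : A) : perp x -> w ** (v ** x) = - (v ** (w ** x)).
Proof.
case=> fo fv fw; apply: (cancel_eq (orthogonal_spectral x) (- 2^-1)).
rewrite fv fw; module_over K.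
Qed.

(** The hypothesis reads r = 2(or + vr + wr). Multiplying it by v and by w, and using w(vr) = -v(wr)
    and w(wr) = v(vr), gives v(vr) = 0, that is or = o(or). Multiplying it by o then gives r = 4(or
    - o(or)) = 0. *)
Lemma reflections_opposite_0 (r : A) : perp r -> ta r + tb r = 0 -> r = 0.
Proof.
move=> pr; have [fo fv fw] := pr.
rewrite /reflection !bilinE /= fo fv fw => e.
have rE : r = 2 *: (o ** r) + 2 *: (v ** r) + 2 *: (w ** r).
  apply: (cancel_eq e (- 2^-1)); module_over K.
have := congr1 (mul v) rE; rewrite !bilinE /= -ovC (perp_ov pr) => e1.
have := congr1 (mul w) rE; rewrite !bilinE /= -owC (perp_ow pr) => e2.
have := congr1 (mul o) rE; rewrite !bilinE /= (perp_ow pr) (perp_ov pr) => e3.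
have vv0 : v ** (v ** r) = 0.
  move: e1 e2; rewrite (perp_wv pr) (perp_ww pr) -(perp_vv pr) => e1 e2.
  apply: (cancel_eq e1 4^-1); apply: (cancel_eq e2 4^-1).
  module_over K.
move: (perp_vv pr); rewrite vv0 => e4.
rewrite {}[LHS]rE; apply: (cancel_eq e3 2); apply: (cancel_eq e4 16).
module_over K.
Qed.

(* The coefficient of [t * u] in the defect of [fusion] at [o/2 + t v + u w]. *)
Definition mixed (x y : A) : A :=
  4 *: ((v ** x) ** (w ** y)) + 4 *: ((w ** x) ** (v ** y))
  - form v (x ** y) *: w - form w (x ** y) *: v
  - form v x *: (w ** y) - form w x *: (v ** y)
  - form v y *: (w ** x) - form w y *: (v ** x).

Lemma mixedC (x y : A) : mixed x y = mixed y x.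
Proof.
rewrite /mixed (mulC x y) (mulC (v ** y)) (mulC (w ** y)); module_over K.
Qed.

Lemma mixedDl (x1 x2 y : A) : mixed (x1 + x2) y = mixed x1 y + mixed x2 y.
Proof. rewrite /mixed !bilinE /=; module_over K. Qed.

Lemma mixedZl (k : K) (x y : A) : mixed (k *: x) y = k *: mixed x y.
Proof. rewrite /mixed !bilinE /=; module_over K. Qed.

Lemma mixed_killed (x y : A) : v ** x = 0 -> w ** x = 0 ->
  form v x = 0 -> form w x = 0 -> mixed x y = 0.
Proof.
move=> vx wx fvx fwx; rewrite /mixed !frob vx wx fvx fwx !bilinE /=.
module_over K.
Qed.

(** At [o], [v] and [w] the expression reduces to spectral identities: [orthogonal_spectral],
    [w_odd] and [v_odd] respectively. *)
Lemma mixed_o (y : A) : mixed o y = 0.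
Proof.
rewrite /mixed !frob !(mulC _ o) ov ow !(formC _ o) fov fow.
apply: (cancel_eq (orthogonal_spectral y) (-2)); module_over K.
Qed.

Lemma mixed_v (y : A) : mixed v y = 0.
Proof.
rewrite /mixed !frob !(mulC w v) vv vw fvv (formC w v) fvw !bilinE /=.
apply: (cancel_eq (w_odd y) (- 2^-1)); module_over K.
Qed.

Lemma mixed_w (y : A) : mixed w y = 0.
Proof.
rewrite /mixed !frob ww vw fww fvw !bilinE /=.
apply: (cancel_eq (v_odd y) (- 2^-1)); module_over K.
Qed.

Definition half_element (x : A) : Prop := o ** x = 2^-1 *: x.

(** If oz = z then (z, x) = (zo, x) = (z, ox) = (z, x)/2. *)
Lemma half_perp (x : A) : half_element x -> perp x.
Proof.
move=> ox.
have f z : o ** z = z -> form z x = 0.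
  move=> oz; have := frob z o x; rewrite (mulC z) oz ox !bilinE /= => e.
  have -> : form z x = 2 * (form z x - 2^-1 * form z x) by field; exact: two.
  by rewrite e subrr mulr0.
by split; apply: f.
Qed.

Lemma half_v (x : A) : half_element x -> half_element (v ** x).
Proof. by move=> ox; rewrite /half_element ovC ox !bilinE. Qed.

Lemma half_w (x : A) : half_element x -> half_element (w ** x).
Proof. by move=> ox; rewrite /half_element owC ox !bilinE. Qed.

Lemma half_vv (x : A) : half_element x -> v ** (v ** x) = 16^-1 *: x.
Proof.
move=> ox; rewrite (perp_vv (half_perp ox)) !ox !bilinE /= ox; module_over K.
Qed.

Lemma half_ww (x : A) : half_element x -> w ** (w ** x) = 16^-1 *: x.
Proof.
move=> ox; rewrite (perp_ww (half_perp ox)) !ox !bilinE /= ox; module_over K.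
Qed.

Lemma reflection_half_v (x : A) : half_element x -> ta x = - 4 *: (v ** x).
Proof.
move=> ox; have [fo fv fw] := half_perp ox.
rewrite /reflection !bilinE /= ox fo fv; module_over K.
Qed.

Lemma reflection_half_w (x : A) : half_element x -> tb x = - 4 *: (w ** x).
Proof.
move=> ox; have [fo fv fw] := half_perp ox.
rewrite /reflection !bilinE /= ox fo fw; module_over K.
Qed.

Lemma mixed_half (x y : A) : half_element x -> half_element y -> mixed x y = 0.
Proof.
move=> hx hy; have [fox fvx fwx] := half_perp hx.
have [foy fvy fwy] := half_perp hy.
have [hvx hvy hwx hwy] := And4 (half_v hx) (half_v hy) (half_w hx) (half_w hy).
have [r r_def] : exists r, r = (v ** x) ** (w ** y) + (w ** x) ** (v ** y).
  by eexists.
(* The reflections map [r] to [x (v (w y)) + (v (w x)) y] and to its opposite. *)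
have r_opp : ta r + tb r = 0.
  rewrite r_def !reflectionD !(reflection_mul axis_vp (v ** x)).
  rewrite !(reflection_mul axis_vp (w ** x)) !(reflection_mul axis_wp (v ** x)).
  rewrite !(reflection_mul axis_wp (w ** x)).
  rewrite !reflection_half_v // !reflection_half_w // !half_vv // !half_ww //.
  rewrite (perp_wv (half_perp hx)) (perp_wv (half_perp hy)) !bilinE /=.
  module_over K.
have adj z t u : form (z ** t) u = form t (z ** u) by rewrite (mulC z) frob.
have fvr : form v r = 2 / 16 * form (w ** x) y.
  rewrite r_def !bilinE /= !(frob v) half_vv // (formC (v ** _)) (adj v) half_vv //.
  rewrite !bilinE /= -(adj w x y) (formC y); field; exact: sixteen.
have fwr : form w r = 2 / 16 * form (v ** x) y.
  rewrite r_def !bilinE /= !(frob w) half_ww // (formC (w ** _)) (adj w) half_ww //.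
  rewrite !bilinE /= -(adj v x y) (formC y); field; exact: sixteen.
have for_ : form o r = 0.
  rewrite r_def !bilinE /= !(frob o) (perp_ov (half_perp hx)) (perp_ow (half_perp hx)).
  rewrite !bilinE /= !adj (perp_wv (half_perp hy)) !bilinE /=; ring.
(* Since (v, v) = (w, w) = 1/2, this removes the components along [v] and [w]. Each of the two is
   fixed by one involution and negated by the other, so [r'] inherits [r_opp]. *)
pose r' := r - (2 * form v r) *: v - (2 * form w r) *: w.
have r'0 : r' = 0.
  apply: reflections_opposite_0.
    split; rewrite /r' !bilinE /= ?for_ ?fov ?fow ?fvv ?fww ?fvw ?(formC w v) ?fvw.
    + ring.
    + field; exact: two.
    + field; exact: two.
  have [tav tbv] : ta v = v /\ tb v = - v.
    split; rewrite /reflection !bilinE /= ov fov ?(mulC w v) ?(formC w v);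
      rewrite ?vv ?vw ?fvv ?fvw; module_over K.
  have [taw tbw] : ta w = - w /\ tb w = w.
    split; rewrite /reflection !bilinE /= ow fow ?ww ?vw ?fww ?fvw; module_over K.
  rewrite /r' !reflectionD !reflectionN !reflectionZ tav taw tbv tbw.
  apply: (cancel_eq r_opp (-1)); module_over K.
rewrite /mixed fvx fwx fvy fwy (frob v) (frob w).
have rE : r = (2 * form v r) *: v + (2 * form w r) *: w.
  by apply: (cancel_eq r'0 (-1)); rewrite /r'; module_over K.
apply: (cancel_eq rE (-4)); rewrite fvr fwr r_def; module_over K.
Qed.

Lemma orthogonal_fusion (x y : A) : mixed x y = 0.
Proof.
(* After the orthogonal projection to the span of [o], [v], [w] is removed, u remains. As v(vy) =
   y/16 on half elements, 16v(vu) is its half part, and the rest is annihilated by [v] and [w]. *)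
have split_x z : exists z1 z2, [/\ half_element z2, v ** z1 = 0, w ** z1 = 0,
    form v z1 = 0 /\ form w z1 = 0 & z = (form o z / 2) *: o +
    (2 * form v z) *: v + (2 * form w z) *: w + z1 + z2].
  have [u u_def] : exists u, u = z - (form o z / 2) *: o - (2 * form v z) *: v
      - (2 * form w z) *: w by eexists.
  have pu : perp u.
    split; rewrite u_def !bilinE /= ?foo ?fov ?fow ?fvv ?fww ?fvw ?(formC _ o);
    rewrite ?(formC w v) ?fov ?fow ?fvw; field; exact: two.
  have hz : half_element (16 *: (v ** (v ** u))).
    rewrite /half_element !bilinE /= ovC (perp_ov pu) !bilinE /=; module_over K.
  exists (u - 16 *: (v ** (v ** u))), (16 *: (v ** (v ** u))).
  have [pvu pwu] := (perp_v pu, perp_w pu).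
  have hvu : half_element (v ** u) by apply: perp_ov.
  have hwu : half_element (w ** u) by apply: perp_ow.
  have [_ fv fw] := pu; have [_ fv' fw'] := half_perp hz.
  split=> //.
  - rewrite !bilinE /= half_vv //; module_over K.
  - rewrite !bilinE /= (perp_wv pvu) (perp_wv pu) !bilinE /= half_vv //.
    module_over K.
  - by rewrite !(linearBr form) /= fv fw fv' fw' subr0.
  - rewrite u_def; module_over K.
have reduce z u : (forall z', half_element z' -> mixed z' u = 0) -> mixed z u = 0.
  have [z1 [z2 [hz vz wz [fvz fwz] ->]]] := split_x z => hu.
  rewrite !mixedDl !mixedZl mixed_o mixed_v mixed_w mixed_killed // hu //.
  by rewrite !scaler0 !addr0.
apply: (reduce) => x' hx; rewrite mixedC; apply: (reduce) => y' hy.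
exact: mixed_half.
Qed.

End Orthogonal.

(** * Primitive idempotents of the plane *)

(** The terms linear in c are multiplied by the weight [r], so that [spectral] becomes the diagonal
    of a bilinear map on pairs and the section on conics applies; [fusion_polar] does the same for
    [fusion]. *)
Definition spectral_polar (x u : A) (r : K) (v : A) (q : K) : A :=
  2 *: (u ** (v ** x)) - r *: (v ** x) - form u x *: v.

Definition fusion_polar (x y u : A) (r : K) (v : A) (q : K) : A :=
  4 *: ((u ** x) ** (v ** y)) + r *: (v ** (x ** y)) - form u (x ** y) *: v
  - r *: (x ** (v ** y)) - r *: (y ** (v ** x))
  - form u x *: (v ** y) - form u y *: (v ** x).

Lemma spectral_polarE (x c : A) : spectral_polar x c 1 c 1 = 0 <-> spectral c x.
Proof.
rewrite /spectral_polar /spectral; split=> e.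
  apply: (cancel_eq e (-1)); module_over K.
apply: (cancel_eq e (-1)); module_over K.
Qed.

Lemma fusion_polarE (x y c : A) : fusion_polar x y c 1 c 1 = 0 <-> fusion c x y.
Proof.
rewrite /fusion_polar /fusion; split=> e.
  apply: (cancel_eq e (-1)); module_over K.
apply: (cancel_eq e (-1)); module_over K.
Qed.

(** The norm is forced: [spectral] at x = c reads 2c = c + (c, c)c. *)
Lemma idempotent_axis (c : A) : c ** c = c -> c <> 0 ->
  (forall x, spectral c x) -> (forall x y, fusion c x y) -> axis c.
Proof.
move=> cc c0 cG cH; split=> //; apply/eqP; rewrite -subr_eq0; apply/eqP.
have [//|fc] := eqVneq (form c c - 1) 0; case: c0.
apply: (scalerI fc); have := cG c; rewrite /spectral !cc => e.
apply: (cancel_eq e 1); module_over K.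
Qed.

Section PlaneIdempotents.
Variables a b : A.
Hypotheses (axis_a : axis a) (axis_b : axis b).
Local Notation phi := (form a b).
Local Notation s := (sig a b).
Local Notation p := ((phi - 1) / 2).
Local Notation m := (4 * phi - 2).
Local Notation pt := (point a b).
Local Notation wt := (weight a b).

Lemma point_sqr (x y z : K) : pt x y z ** pt x y z =
  pt (x * wt x y z) (y * wt x y z) (p * z ^+ 2 + 2 * x * y).
Proof.
have [aa _ _ _] := axis_a; have [bb _ _ _] := axis_b.
rewrite /point /weight !bilinE /= aa bb (mulC s a) (mulC s b) (mulC b a).
rewrite mul_ab (mul_a_sig _ axis_a) (mul_b_sig _ axis_b) (mul_sig_sig axis_a axis_b).
module_over K.
Qed.

Lemma plane_identities (x y z : K) : m + 1 != 0 ->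
  wt x y z = 1 -> 2 * x * y = p * z ^+ 2 + (x + y) * z ->
  (forall X, spectral (pt x y z) X) /\ forall X Y, fusion (pt x y z) X Y.
Proof.
move=> m1 w1 xyz.
have GP X : [/\ forall k u r u' r' v q,
    spectral_polar X (k *: u + u') (k * r + r') v q =
      k *: spectral_polar X u r v q + spectral_polar X u' r' v q,
  forall k u r v q v' q',
    spectral_polar X u r (k *: v + v') (k * q + q') =
      k *: spectral_polar X u r v q + spectral_polar X u r v' q' &
  forall c, axis c -> spectral_polar X c 1 c 1 = 0].
  split=> [*|*|c [_ _ cG _]]; last exact/spectral_polarE.
    rewrite /spectral_polar !bilinE /=; module_over K.
  rewrite /spectral_polar !bilinE /=; module_over K.
have HP X Y : [/\ forall k u r u' r' v q,
    fusion_polar X Y (k *: u + u') (k * r + r') v q =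
      k *: fusion_polar X Y u r v q + fusion_polar X Y u' r' v q,
  forall k u r v q v' q',
    fusion_polar X Y u r (k *: v + v') (k * q + q') =
      k *: fusion_polar X Y u r v q + fusion_polar X Y u r v' q' &
  forall c, axis c -> fusion_polar X Y c 1 c 1 = 0].
  split=> [*|*|c [_ _ _ cH]]; last exact/fusion_polarE.
    rewrite /fusion_polar !bilinE /=; module_over K.
  rewrite /fusion_polar !bilinE /=; module_over K.
have [m0|m0] := eqVneq m 0; last first.
  split=> [X|X Y].
    have [Pl Pr PA] := GP X; apply/spectral_polarE; rewrite -w1.
    exact: (conic_vanish axis_a axis_b Pl Pr PA).
  have [Pl Pr PA] := HP X Y; apply/fusion_polarE; rewrite -w1.
  exact: (conic_vanish axis_a axis_b Pl Pr PA).
have four : 4 != 0 :> K by rewrite (natrM _ 2 2) mulf_neq0.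
have phiE : phi = 2^-1.
  have -> : phi = (m + 2) / 4 by field.
  by rewrite m0; field; rewrite two four.
have [aa faa _ _] := axis_a; have [bb fbb _ _] := axis_b.
have ss := mul_sig_sig axis_a axis_b.
have [as_ bs_] := (mul_a_sig b axis_a, mul_b_sig a axis_b).
have [fas fbs fss] := And3 (form_a_sig b axis_a) (form_b_sig a axis_b)
  (form_sig_sig axis_a axis_b).
have abE := mul_ab a b.
rewrite phiE in as_ bs_ ss fas fbs fss.
have sa : s ** a = ((2^-1 - 1) / 2) *: a by rewrite mulC.
have sb : s ** b = ((2^-1 - 1) / 2) *: b by rewrite mulC.
have ba := mulC b a; rewrite abE in ba.
have fba := formC b a; rewrite phiE in fba.
have [fsa fsb] := (formC s a, formC s b); rewrite fas in fsa; rewrite fbs in fsb.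
(* Here p = -1/4, so -4s is idempotent and fixes a and b; [v] and [w] are a - o/2 and b - o/2. *)
pose o := (-4) *: s; pose v := a + 2 *: s; pose w := b + 2 *: s.
have oo : o ** o = o by rewrite /o !bilinE /= ss; module_over K.
have ov : o ** v = v by rewrite /o /v !bilinE /= sa ss; module_over K.
have ow : o ** w = w by rewrite /o /w !bilinE /= sb ss; module_over K.
have vv : v ** v = 4^-1 *: o.
  by rewrite /o /v !bilinE /= aa sa ss as_; module_over K.
have ww : w ** w = 4^-1 *: o.
  by rewrite /o /w !bilinE /= bb sb ss bs_; module_over K.
have vw : v ** w = 0.
  by rewrite /v /w !bilinE /= abE sb as_ ss; module_over K.
have foo : form o o = 2.
  by rewrite /o !bilinE /= fss; field; rewrite ?two.
have fov : form o v = 0.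
  by rewrite /o /v !bilinE /= fsa fss; field; rewrite ?two.
have fow : form o w = 0.
  by rewrite /o /w !bilinE /= fsb fss; field; rewrite ?two.
have fvv : form v v = 2^-1.
  by rewrite /v !bilinE /= fsa fas faa fss; field; rewrite ?two.
have fww : form w w = 2^-1.
  by rewrite /w !bilinE /= fsb fbs fbb fss; field; rewrite ?two.
have fvw : form v w = 0.
  by rewrite /v /w !bilinE /= phiE fas fsb fss; field; rewrite ?two.
have axis_vp : axis (2^-1 *: o + v).
  by have -> : 2^-1 *: o + v = a by rewrite /o /v; module_over K.
have axis_wp : axis (2^-1 *: o + w).
  by have -> : 2^-1 *: o + w = b by rewrite /o /w; module_over K.
(* For m = 0 the involution of b sends a to o - a, and that of a sends b to o - b. *)
have axis_vm : axis (2^-1 *: o - v).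
  have -> : 2^-1 *: o - v = reflection b a.
    by rewrite /reflection ba fba /o /v; module_over K.
  exact: reflection_axis.
have axis_wm : axis (2^-1 *: o - w).
  have -> : 2^-1 *: o - w = reflection a b.
    by rewrite /reflection abE phiE /o /w; module_over K.
  exact: reflection_axis.
split=> [X|X Y].
  have [Pl Pr PA] := GP X; apply/spectral_polarE; rewrite -w1.
  rewrite (conic_half axis_a axis_b Pl Pr PA m1) // -/v -/w.
  have := orthogonal_spectral oo ow vw fow fvw axis_vp axis_wp axis_wm X.
  move=> e; rewrite /spectral_polar.
  by apply: (cancel_eq e (- (x * y))); module_over K.
have [Pl Pr PA] := HP X Y; apply/fusion_polarE; rewrite -w1.
rewrite (conic_half axis_a axis_b Pl Pr PA m1) // -/v -/w.
have := orthogonal_fusion oo ov ow vv ww vw foo fov fow fvv fww fvw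
  axis_vp axis_vm axis_wp axis_wm X Y.
rewrite /mixed => e; rewrite /fusion_polar.
by apply: (cancel_eq e (- (x * y))); module_over K.
Qed.

(** Pairing with a, b and s gives a linear system. If phi = 1 and y is nonzero, multiplying by a and
    by b gives ab = a = b. Otherwise x = y = -pz with zp phi = 0, and for phi = 0 the point is z
    ab. *)
Lemma point_dependent (x y z : K) : pt x y z = 0 ->
  [\/ [/\ x = 0, y = 0 & z = 0], phi = 1 /\ s = 0 | phi = 0 /\ a ** b = 0].
Proof.
move=> xyz.
have [aa fa _ _] := axis_a; have [bb fb _ _] := axis_b.
have [as_ bs_] := (mul_a_sig b axis_a, mul_b_sig a axis_b).
have ea : x + y * phi + z * p = 0.
  have := congr1 (form a) xyz; rewrite /point !bilinE /= fa (form_a_sig b axis_a).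
  by rewrite mulr1.
have eb : x * phi + y + z * p = 0.
  have := congr1 (form b) xyz; rewrite /point !bilinE /= fb (form_b_sig a axis_b).
  by rewrite mulr1 (formC b a).
have es : p * (x + y + (phi - 1) * z) = 0.
  have := congr1 (form s) xyz; rewrite /point !bilinE /= (formC s a) (formC s b).
  rewrite (form_a_sig b axis_a) (form_b_sig a axis_b).
  rewrite (form_sig_sig axis_a axis_b) => <-; field; exact: two.
have [phi1|phi1] := eqVneq phi 1.
  rewrite phi1 subrr mul0r mulr0 addr0 mulr1 in ea.
  have xE : x = - y by apply/eqP; rewrite -addr_eq0 ea.
  have [y0|y0] := eqVneq y 0.
    move: xyz; rewrite /point xE y0 oppr0 !scale0r !add0r => /eqP.
    rewrite scaler_eq0 => /predU1P[z0|/eqP s0]; last by constructor 2.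
    by constructor 1.
  constructor 2; split=> //.
  have ab_a : a ** b = a.
    apply: (scalerI y0); have := congr1 (mul a) xyz.
    rewrite /point !bilinE /= aa as_ phi1 xE => e.
    apply: (cancel_eq e (-1)); module_over K.
  have ab_b : a ** b = b.
    apply: (scalerI y0); have := congr1 (mul b) xyz.
    rewrite /point !bilinE /= bb bs_ phi1 xE (mulC b a) => e.
    apply: (cancel_eq e 1); module_over K.
  have ba : b = a by rewrite -ab_b ab_a.
  by rewrite /sig -lock ab_a ba; module_over K.
have p0 : p != 0 by rewrite mulf_neq0 ?invr_eq0 // subr_eq0.
have {}es : x + y + (phi - 1) * z = 0.
  by apply: (mulfI p0); rewrite es mulr0.
have xy : x = y.
  apply: (mulfI (_ : 1 - phi != 0)); first by rewrite subr_eq0 eq_sym.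
  have -> : (1 - phi) * x = (1 - phi) * y + (x + y * phi + z * p)
    - (x * phi + y + z * p) by ring.
  by rewrite ea eb; ring.
have yE : y = - p * z.
  apply: (mulfI two).
  have -> : 2 * y = (y + y + (phi - 1) * z) - (phi - 1) * z by ring.
  by rewrite -{1}xy es; field; exact: two.
have : z * (p * phi) = 0.
  move: ea; rewrite xy yE => ea.
  by rewrite -[RHS]oppr0 -ea; field; exact: two.
move/eqP; rewrite mulf_eq0 [p * phi == 0]mulf_eq0 (negPf p0) /=.
move=> /orP[/eqP z0|/eqP phi0].
  by constructor 1; rewrite xy yE z0 mulr0.
have [z0|z0] := eqVneq z 0; first by constructor 1; rewrite xy yE z0 mulr0.
constructor 3; split=> //; apply: (scalerI z0).
rewrite scaler0 -xyz /point xy yE phi0 mul_ab; module_over K.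
Qed.

Lemma plane_axis (B : set A) (x y z : K) : B a -> B b ->
  4 * phi - 2 + 1 != 0 \/ phi = 1 /\ s = 0 ->
  primitive_idempotent mul B (pt x y z) -> axis (pt x y z).
Proof.
move=> Ba Bb generic [_ c0 cc prim].
have {}cc : pt x y z ** pt x y z = pt x y z := cc.
have [aa fa _ _] := axis_a; have [bb fb _ _] := axis_b.
have a0 : a <> 0 by move=> a0; move/eqP: fa; rewrite a0 !bilinE eq_sym oner_eq0.
have [[phi1 s0]|not_line] := pselect (phi = 1 /\ s = 0).
  have ptE : pt x y z = x *: a + y *: b by rewrite /point s0; module_over K.
  rewrite ptE in c0 cc *.
  have xy1 : x + y = 1.
    have : (x + y - 1) *: (x *: a + y *: b) = 0.
      move: cc; rewrite !bilinE /= aa bb (mulC b a) mul_ab s0 => e.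
      by apply: (cancel_eq e (-1)); module_over K.
    move/eqP; rewrite scaler_eq0 => /orP[|/eqP //].
    by rewrite subr_eq0 => /eqP.
  apply: idempotent_axis => // [X|X Y].
    apply/spectral_polarE; apply: (conic_line axis_a axis_b) => //.
    - by move=> *; rewrite /spectral_polar !bilinE /=; module_over K.
    - by move=> *; rewrite /spectral_polar !bilinE /=; module_over K.
    - by move=> c [_ _ cG _]; apply/spectral_polarE.
  apply/fusion_polarE; apply: (conic_line axis_a axis_b) => //.
  - by move=> *; rewrite /fusion_polar !bilinE /=; module_over K.
  - by move=> *; rewrite /fusion_polar !bilinE /=; module_over K.
  - by move=> c [_ _ _ cH]; apply/fusion_polarE.
have [[phi0 ab0]|not_sum] := pselect (phi = 0 /\ a ** b = 0).
  have [u [v cE]] : exists u v, pt x y z = u *: a + v *: b.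
    exists (x - z / 2), (y - z / 2).
    by rewrite /point /sig -lock ab0; module_over K.
  rewrite cE in c0 cc prim *.
  have ba0 : b ** a = 0 by rewrite mulC.
  have fba : form b a = 0 by rewrite formC.
  have uu : u * u = u.
    have := congr1 (form a) cc.
    by rewrite !bilinE /= aa bb ab0 ba0 !bilinE /= fa phi0 !(mulr0, mulr1, addr0).
  have vv : v * v = v.
    have := congr1 (form b) cc.
    rewrite !bilinE /= aa bb ab0 ba0 !bilinE /= fb fba.
    by rewrite !(mulr0, mulr1, add0r, addr0).
  have idem (k : K) : k * k = k -> k = 0 \/ k = 1.
    move=> kk; have [->|k0] := eqVneq k 0; [by left | right].
    by apply: (mulfI k0); rewrite mulr1.
  move: prim c0; case: (idem u uu) => ->; case: (idem v vv) => ->;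
    rewrite ?scale0r ?scale1r ?addr0 ?add0r => prim c0 //.
  (* The only idempotents left are a, b and a + b. The last fixes a, so primitivity would give a =
     k(a + b), and multiplication by b yields kb = 0. *)
  have [k _ kE] : line (a + b) a.
    by rewrite -prim; split=> //=; rewrite !bilinE /= aa ba0 addr0.
  have := congr1 (mul b) kE; rewrite !bilinE /= bb ba0 add0r => /eqP.
  rewrite scaler_eq0 => /predU1P[k0|/eqP b0].
    by case: a0; rewrite -kE k0 scale0r.
  by move/eqP: fb; rewrite b0 !bilinE eq_sym oner_eq0.
have indep u v t : pt u v t = 0 -> [/\ u = 0, v = 0 & t = 0].
  by move/point_dependent => [].
have pt_inj u v t u' v' t' : pt u v t = pt u' v' t' -> [/\ u = u', v = v' & t = t'].
  move=> e; have : pt (u - u') (v - v') (t - t') = 0.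
    rewrite /point in e *; apply: (cancel_eq e (-1)); module_over K.
  by case/indep => /subr0_eq ? /subr0_eq ? /subr0_eq ?.
have := cc; rewrite point_sqr => /pt_inj [ex ey ez].
(* Comparing coordinates in the square: weight one puts c on the conic; any other weight forces x =
   y = 0. *)
have [w1|w1] := eqVneq (wt x y z) 1.
  have xyz : 2 * x * y = p * z ^+ 2 + (x + y) * z.
    have -> : x + y = wt x y z - (phi - 1) * z by rewrite /weight; ring.
    have -> : 2 * x * y = (p * z ^+ 2 + 2 * x * y) - p * z ^+ 2 by ring.
    rewrite ez w1; field; exact: two.
  case: generic => [m1|//].
  by have [cG cH] := plane_identities m1 w1 xyz; apply: idempotent_axis.
have zero_coord u : u * wt x y z = u -> u = 0.
  move=> uw; apply: (mulIf (_ : wt x y z - 1 != 0)); first by rewrite subr_eq0.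
  by rewrite mulrBr uw mulr1 subrr mul0r.
have [x0 y0] := (zero_coord _ ex, zero_coord _ ey).
have [z0|z0] := eqVneq z 0.
  by case: c0; rewrite x0 y0 z0 /point !scale0r !addr0.
(* Now c = zs fixes a, which is not on its line, against primitivity. *)
have pz : z * p = 1.
  by apply: (mulfI z0); rewrite -[in RHS]ez x0; ring.
have [k _] : line (pt x y z) a.
  rewrite -prim; split=> //=; rewrite x0 y0 /point !scale0r !add0r.
  rewrite !bilinE /= (mulC s a) (mul_a_sig b axis_a) scalerA pz scale1r.
  by [].
have a_pt : a = pt 1 0 0 by rewrite /point; module_over K.
have -> : k *: pt x y z = pt 0 0 (k * z) by rewrite x0 y0 /point; module_over K.
rewrite [RHS]a_pt => /pt_inj [/eqP]; by rewrite eq_sym oner_eq0.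
Qed.

End PlaneIdempotents.
End Axes.

(** * Base change *)

Section BilinearBaseChange.
Variables (F E : fieldType) (iota : {rmorphism F -> E}).
Variables (A : lmodType F) (mul : {bilinear A -> A -> A}).
Variables (AE : lmodType E) (mulE : {bilinear AE -> AE -> AE}).
Variable j : {linear A -> AE | iota \; *:%R}.
Hypothesis bc : base_change mul mulE j.

Lemma base_change_lift (V : lmodType E) (f : A -> V) :
  linear_for (iota \; *:%R) f ->
  exists g : {linear AE -> V}, forall x, g (j x) = f x.
Proof.
move=> f_lin.
pose f' : {linear A -> V | iota \; *:%R} :=
  HB.pack f (GRing.isLinear.Build F A V _ f f_lin).
by have [[g gf] _] := bc.2 V f'; exists g.
Qed.

Lemma base_change_ext (V : lmodType E) (g h : AE -> V) :
  linear g -> linear h -> (forall x, g (j x) = h (j x)) -> g =1 h.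
Proof.
move=> g_lin h_lin gh.
have f_lin : linear_for (iota \; *:%R) (g \o j).
  by move=> k x y; rewrite /= linearP g_lin.
pose f : {linear A -> V | iota \; *:%R} :=
  HB.pack (g \o j) (GRing.isLinear.Build F A V _ (g \o j) f_lin).
pose g' : {linear AE -> V} := HB.pack g (GRing.isLinear.Build E AE V _ g g_lin).
pose h' : {linear AE -> V} := HB.pack h (GRing.isLinear.Build E AE V _ h h_lin).
have [_ uniq_lift] := bc.2 V f.
exact: (uniq_lift g' h' (fun x => erefl) (fun x => esym (gh x))).
Qed.

(** The form is lifted one variable at a time, with values in E as a module over itself; uniqueness
    of lifts gives linearity in the variable already extended. *)
Lemma base_change_form (form : {biscalar A}) :
  exists formE : {biscalar AE}, forall x y, formE (j x) (j y) = iota (form x y).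
Proof.
have inner_lin x : linear_for (iota \; *:%R) (fun y => iota (form x y) : E^o).
  by move=> k y z; rewrite linearPr rmorphD rmorphM.
pose inner x := projT1 (cid (base_change_lift (inner_lin x))).
have innerE x y : inner x (j y) = iota (form x y) :=
  projT2 (cid (base_change_lift (inner_lin x))) y.
have outer_lin t : linear_for (iota \; *:%R) (fun x => inner x t : E^o).
  move=> k x y; move: t.
  apply: (@base_change_ext E^o (inner (k *: x + y))
    (fun t => iota k *: (inner x t) + inner y t)).
  - by move=> c u v; rewrite linearP.
  - by move=> c u v; rewrite !linearP /=; module_over E.
  - by move=> z; rewrite !innerE linearPl rmorphD rmorphM.
pose outer t := projT1 (cid (base_change_lift (outer_lin t))).
have outerE t x : outer t (j x) = inner x t :=
  projT2 (cid (base_change_lift (outer_lin t))) x.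
have bilin : bilinear_for *%R *%R (fun s t => outer t s : E).
  split=> [t k u v|s k u v]; first exact: (linearP (outer t)).
  move: s; apply: (@base_change_ext E^o (outer (k *: u + v))
    (fun s => k *: (outer u s) + outer v s)).
  - by move=> c x y; rewrite linearP.
  - by move=> c x y; rewrite !linearP /=; module_over E.
  - by move=> z; rewrite !outerE linearP.
pose formE : {biscalar AE} := HB.pack (fun s t => outer t s : E)
  (bilinear_isBilinear.Build E AE AE E _ _ _ bilin).
by exists formE => x y; rewrite -innerE -outerE.
Qed.

End BilinearBaseChange.

Section Transfer.
Variables (F E : fieldType) (iota : {rmorphism F -> E}).
Variables (A : lmodType F) (mul : {bilinear A -> A -> A}) (form : {biscalar A}).
Variables (AE : lmodType E) (mulE : {bilinear AE -> AE -> AE}).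
Variables (formE : {biscalar AE}) (j : {linear A -> AE | iota \; *:%R}).
Hypothesis bc : base_change mul mulE j.
Hypothesis formjE : forall x y, formE (j x) (j y) = iota (form x y).

Let mulj (x y : A) : mulE (j x) (j y) = j (mul x y). Proof. exact: bc.1. Qed.
Let ext := base_change_ext bc.

Lemma base_change_mulC : commutative mul -> commutative mulE.
Proof.
move=> mulC s t; move: s.
apply: ext => [k x y|k x y|x]; [by rewrite linearPl|by rewrite linearPr|].
move: t; apply: ext => [k y z|k y z|y]; [by rewrite linearPr|by rewrite linearPl|].
by rewrite !mulj mulC.
Qed.

Lemma base_change_formC : (forall x y, form x y = form y x) ->
  forall s t, formE s t = formE t s.
Proof.
move=> formC s t; move: s.
apply: (@ext E^o) => [k x y|k x y|x]; [by rewrite linearPl|by rewrite linearPr|].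
move: t; apply: (@ext E^o) => [k y z|k y z|y]; [by rewrite linearPr|by rewrite linearPl|].
by rewrite !formjE formC.
Qed.

Lemma base_change_frobenius : frobenius mul form -> frobenius mulE formE.
Proof.
move=> frob s t u; move: s.
apply: (@ext E^o) => [k x y|k x y|x].
- by rewrite linearPl.
- by rewrite !linearPl.
move: t; apply: (@ext E^o) => [k y z|k y z|y].
- by rewrite linearPl linearPr.
- by rewrite linearPr linearPl.
move: u; apply: (@ext E^o) => [k z u|k z u|z].
- by rewrite !linearPr.
- by rewrite !linearPr.
by rewrite !mulj !formjE frob.
Qed.

(** With [j c] fixed, both identities are linear in the remaining variables, so checking them on the
    image of [j] suffices. *)
Lemma base_change_axis (c : A) : axis mul form c -> axis mulE formE (j c).
Proof.
case=> cc fc cG cH; split=> [||s|s t].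
- by rewrite mulj cc.
- by rewrite formjE fc rmorph1.
- rewrite /spectral; move: s; apply: ext => [k x y|k x y|x].
  + by rewrite !bilinE /=; module_over E.
  + by rewrite !bilinE /=; module_over E.
  rewrite !mulj formjE; have := congr1 j (cG x).
  by rewrite linearD !linearZ_LR /= rmorph_nat.
- rewrite /fusion; move: s; apply: ext => [k x y|k x y|x].
  + by rewrite !bilinE /=; module_over E.
  + by rewrite !bilinE /=; module_over E.
  move: t; apply: ext => [k y z|k y z|y].
  + by rewrite !bilinE /=; module_over E.
  + by rewrite !bilinE /=; module_over E.
  rewrite !mulj !formjE; have := congr1 j (cH x y).
  by rewrite !linearD linearN !linearZ_LR /= rmorph_nat.
Qed.

Lemma base_change_sig (a b : A) : j (sig mul a b) = sig mulE (j a) (j b).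
Proof.
rewrite /sig -!lock linearB linearZ_LR linearD /= -mulj.
by rewrite fmorphV rmorph_nat.
Qed.

Lemma base_change_point (a b : A) (x y z : F) :
  j (point mul a b x y z) = point mulE (j a) (j b) (iota x) (iota y) (iota z).
Proof. by rewrite /point !linearD !linearZ_LR /= base_change_sig. Qed.

End Transfer.

(** Commutativity and the Frobenius law give (xy, z) = (x, zy) = (zx, y) = (z, xy), and every
    generator is a product because it is idempotent. *)
Lemma axial_form_sym (F : fieldType) (A : lmodType F)
    (mul : {bilinear A -> A -> A}) (form : {biscalar A}) (X : set A) :
  primitive_axial_jordan mul X -> frobenius mul form ->
  forall x y, form x y = form y x.
Proof.
move=> [mulC [axes gen]] frob.
pose S := [set x | forall y, form x y = form y x].
have mulS x y : S (mul x y).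
  by move=> z; rewrite -frob (mulC y) frob (mulC x) -frob.
have SX : generated mul X `<=` S.
  apply: smallest_sub; last first.
    by move=> x /axes [[_ xx _ _] _]; rewrite -xx; apply: mulS.
  split; last by move=> x y _ _; apply: mulS.
  split=> [y|k x y Sx Sy z].
    by rewrite (linear0l form) (linear0r form).
  by rewrite linearPl linearPr Sx Sy.
by move=> x; apply: SX; rewrite gen.
Qed.

(** * The subalgebra generated by two axes, and solidity *)

Section GeneratedPlane.
Variables (F : fieldType) (A : lmodType F).
Variables (mul : {bilinear A -> A -> A}) (form : {biscalar A}).
Hypothesis two : 2 != 0 :> F.
Hypothesis mulC : commutative mul.
Hypothesis formC : forall x y, form x y = form y x.
Hypothesis frob : frobenius mul form.
Variables a b : A.
Hypotheses (axis_a : axis mul form a) (axis_b : axis mul form b).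
Local Notation B := (generated mul [set a; b]).

Lemma generated_a : B a. Proof. by move=> S [_ abS]; apply: abS => /=; left. Qed.
Lemma generated_b : B b. Proof. by move=> S [_ abS]; apply: abS => /=; right. Qed.

Lemma generated_plane :
  B = [set v | exists x y z, v = point mul a b x y z].
Proof.
have [[B0 BP] BM] : subalgebra mul B.
  split; first split.
  - by move=> S [[[S0 _] _] _].
  - move=> k x y Bx By S SP; have [[[_ linS] _] _] := SP.
    by apply: linS; [apply: Bx|apply: By].
  - move=> x y Bx By S SP; have [[_ mulS] _] := SP.
    by apply: mulS; [apply: Bx|apply: By].
apply/seteqP; split=> v.
  apply: smallest_sub; first last.
    move=> _ [->|->].
      by exists 1, 0, 0; rewrite /point; module_over F.
    by exists 0, 1, 0; rewrite /point; module_over F.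
  split; [split|].
  - by exists 0, 0, 0; rewrite /point; module_over F.
  - move=> k _ _ [x [y [z ->]]] [x' [y' [z' ->]]].
    by exists (k * x + x'), (k * y + y'), (k * z + z'); rewrite /point; module_over F.
  move=> _ _ [x [y [z ->]]] [x' [y' [z' ->]]].
  have [aa fa _ _] := axis_a; have [bb fb _ _] := axis_b.
  set p := (form a b - 1) / 2.
  exists (x * x' + 2^-1 * (x * y' + y * x') + p * (x * z' + z * x')),
    (y * y' + 2^-1 * (x * y' + y * x') + p * (y * z' + z * y')),
    (p * (z * z') + (x * y' + y * x')).
  rewrite /point !bilinE /= aa bb (mulC (sig _ _ _) a) (mulC (sig _ _ _) b) (mulC b a).
  rewrite mul_ab (mul_a_sig two b axis_a) (mul_b_sig two mulC formC a axis_b).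
  rewrite (mul_sig_sig two mulC formC frob axis_a axis_b).
  by rewrite /p; module_over F.
move=> [x [y [z ->]]].
have BZ k u : B u -> B (k *: u) by move=> Bu; rewrite -[_ *: _]addr0; apply: BP.
have BD u u' : B u -> B u' -> B (u + u').
  by move=> Bu Bu'; rewrite -[u]scale1r; apply: BP.
have Bs : B (sig mul a b).
  rewrite /sig -lock -scaleN1r; apply: (BD); last apply: (BZ); last apply: (BZ).
    by apply: BM; [apply: generated_a|apply: generated_b].
  by apply: (BD); [apply: generated_a|apply: generated_b].
by rewrite /point; apply: (BD); [apply: (BD)|]; apply: (BZ);
  [apply: generated_a|apply: generated_b|].
Qed.

(** If m + 1 = 0 and the dimension is not 3, then a, b, s are dependent, and phi = 0 is impossible
    since it makes m + 1 = -1. Both alternatives of [point_dependent] are compared with 1/4 because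
    1/4 = 1 in characteristic three. *)
Lemma dim3_or_degenerate :
  4 * form a b - 2 + 1 != 0 \/ ~ has_dim 3 B ->
  4 * form a b - 2 + 1 != 0 \/ form a b = 1 /\ sig mul a b = 0.
Proof.
case=> [|no_dim3]; first by left.
have [m1|m1] := eqVneq (4 * form a b - 2 + 1) 0; last by left.
right; have [//|not_line] := pselect (form a b = 1 /\ sig mul a b = 0).
case: no_dim3.
pose v (i : 'I_3) := nth 0 [:: a; b; sig mul a b] i.
have sumE (k : 'I_3 -> F) : \sum_i k i *: v i =
    point mul a b (k ord0) (k (lift ord0 ord0)) (k (lift ord0 (lift ord0 ord0))).
  by rewrite !big_ord_recl big_ord0 /v /point /= addr0 addrA.
exists v; split.
  move=> k; rewrite sumE.
  move=> /(point_dependent two mulC formC frob axis_a axis_b).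
  case=> [[k0 k1 k2]|//|[phi0 _]]; last first.
    move/eqP: m1; rewrite phi0 mulr0 add0r.
    have -> : - 2 + 1 = -1 :> F by ring.
    by rewrite oppr_eq0 oner_eq0.
  case=> [[|[|[|//]]] lt_i].
  - by rewrite -[RHS]k0; congr (k _); apply: val_inj.
  - by rewrite -[RHS]k1; congr (k _); apply: val_inj.
  - by rewrite -[RHS]k2; congr (k _); apply: val_inj.
rewrite generated_plane; apply/seteqP; split=> u.
  move=> [x [y [z ->]]]; exists (fun i : 'I_3 => nth 0 [:: x; y; z] i).
    by [].
  exact: sumE.
by move=> [k _ <-]; rewrite sumE; do 3!eexists.
Qed.

End GeneratedPlane.

Theorem theorem1p1 (F : fieldType) (A : lmodType F)
    (mul : {bilinear A -> A -> A}) (X : set A)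
    (charF : 2%N \notin [pchar F])
    (AX : primitive_axial_jordan mul X)
    (form : {biscalar A})
    (form_frobenius : frobenius mul form)
    (form1 : forall x : A, X x -> form x x = 1)
    (a b : A) (Xa : X a) (Xb : X b) :
  form a b <> 4^-1 \/ ~ has_dim 3 (generated mul [set a; b]) ->
  solid mul (generated mul [set a; b]).
Proof.
move=> generic E iota _ AE mulE j bc c prim.
have two : 2 != 0 :> F by move: charF; rewrite inE /=.
have four : 4 != 0 :> F by rewrite (natrM _ 2 2) mulf_neq0.
have twoE : 2 != 0 :> E by rewrite -(rmorph_nat iota) fmorph_eq0.
have formC := axial_form_sym AX form_frobenius.
have [mulC [axes _]] := AX.
have axis_a : axis mul form a.
  by apply: jordan_axis_axis => //; [apply: axes|apply: form1].
have axis_b : axis mul form b.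
  by apply: jordan_axis_axis => //; [apply: axes|apply: form1].
have [formE formjE] := base_change_form bc form.
have mulCE := base_change_mulC bc mulC.
have formCE := base_change_formC bc formjE formC.
have frobE := base_change_frobenius bc formjE form_frobenius.
have axis_ja := base_change_axis bc formjE axis_a.
have axis_jb := base_change_axis bc formjE axis_b.
have planeE := generated_plane two mulC formC form_frobenius axis_a axis_b.
(* The dimension hypothesis is spent over F; its consequence, an inequality or two equations, passes
   to E. *)
have {}generic : 4 * formE (j a) (j b) - 2 + 1 != 0 \/
    formE (j a) (j b) = 1 /\ sig mulE (j a) (j b) = 0.
  rewrite formjE -(base_change_sig bc).
  have [|m1|[-> ->]] := dim3_or_degenerate two mulC formC form_frobenius
    axis_a axis_b.
  - case: generic => [quarter|]; [left | by right].
    apply/eqP => m1; apply: quarter; apply: (mulfI four); rewrite divff //.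
    have -> : 4 * form a b = (4 * form a b - 2 + 1) + 1 by ring.
    by rewrite m1 add0r.
  - left; rewrite -(rmorph_nat iota 4) -(rmorph_nat iota 2) -(rmorph1 iota).
    by rewrite -rmorphM -rmorphB -rmorphD fmorph_eq0.
  - by right; rewrite rmorph1 linear0.
set S := Defs.span _ in prim.
have Sj x : generated mul [set a; b] x -> S (j x).
  by move=> Bx T [_ jBT]; apply: jBT; exists x.
(* The image of B consists of points of the plane of [j a] and [j b], and this plane is a subspace,
   so it contains the E-span. *)
have [x [y [z cE]]] : exists x y z, c = point mulE (j a) (j b) x y z.
  have [Sc _ _ _] := prim; move: c Sc {prim}.
  apply: smallest_sub; last first.
    move=> _ [u Bu <-]; move: Bu; rewrite planeE => -[x [y [z ->]]].
    by do 3!eexists; apply: base_change_point.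
  split; first by exists 0, 0, 0; rewrite /point; module_over E.
  move=> k _ _ [x [y [z ->]]] [x' [y' [z' ->]]].
  by exists (k * x + x'), (k * y + y'), (k * z + z'); rewrite /point; module_over E.
rewrite cE in prim *.
apply: (axis_jordan (form := formE)) => //.
apply: (plane_axis _ _ _ _ axis_ja axis_jb _ _ _ prim) => //.
- by apply: Sj; apply: generated_a.
- by apply: Sj; apply: generated_b.
Qed.
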